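(* Let $\mu$ be a Borel probability measure on $\mathbb{R}$ which has a logarithmic gradient $v_\mu$, and let $v,K:\mathbb{R}\to\mathbb{R}$ be functions related by $v=\delta_\mu(K)$. Assume that for some $\alpha>0$ $$K v'\ge\alpha .$$ Assume in addition that the functions $K$ and $$a:=2KK'+K^2v_\mu$$ belong to $C^\infty$, have at most linear growth at $\infty$, and all their derivatives have at most polynomial growth at $\infty$. Then for every smooth $f:\mathbb{R}\to\mathbb{R}$ with compact support, $$\mathbf{Ent}_\mu(f^2)\le\frac{2}{\alpha}\,\mathbf{E}_\mu\big(Kf'\big)^2 .$$ As a corollary, if $K$ is bounded, then for every absolutely continuous $f$ such that both $f$ and $f'$ are square integrable with respect to $\mu$, $$\mathbf{Ent}_\mu(f^2)\le\frac{2}{\alpha}\Big(\sup_x K^2(x)\Big)\mathbf{E}_\mu\big(f'\big)^2 .$$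
   Context: $\mathbf{E}_\mu f=\int f\,d\mu$, and $\mathbf{E}_\mu(g)^2$ means $\int g^2\,d\mu$. For $f\ge0$, $\mathbf{Ent}_\mu(f)=\mathbf{E}_\mu(f\log f)-(\mathbf{E}_\mu f)\log(\mathbf{E}_\mu f)$, with $0\log0=0$. Logarithmic gradient: $\mu$ has logarithmic gradient $v_\mu:\mathbb{R}\to\mathbb{R}$ if $v_\mu$ is $\mu$-integrable and $\mathbf{E}_\mu f'=-\mathbf{E}_\mu(v_\mu f)$ for every smooth compactly supported $f:\mathbb{R}\to\mathbb{R}$. (Equivalently, $\mu$ has a Lebesgue density $p_\mu\in W_{1,1}(\mathbb{R})$, and then $v_\mu=p_\mu'/p_\mu$.) $\mu$-divergence: for $g:\mathbb{R}\to\mathbb{R}$, the $\mu$-divergence, if it exists, is the function $\delta_\mu(g)\in L_1(\mathbb{R},\mu)$ such that $\mathbf{E}_\mu(f'g)=\mathbf{E}_\mu\big(f\,\delta_\mu(g)\big)$ for every smooth compactly supported $f:\mathbb{R}\to\mathbb{R}$; for differentiable $K$ as here, $\delta_\mu(K)=-Kv_\mu-K'$. *)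

(* Defs.v *)
From HB Require Import structures.
From mathcomp Require Import all_boot all_order all_algebra.
From mathcomp Require Import all_classical all_reals all_analysis.

Set Implicit Arguments.
Unset Strict Implicit.
Unset Printing Implicit Defensive.

Import Order.TTheory GRing.Theory Num.Theory.
Import numFieldNormedType.Exports.

Local Open Scope classical_set_scope.
Local Open Scope ring_scope.

Section functions.
Context {R : realType}.
Implicit Types f g : R -> R.

Definition smooth f := forall (n : nat) (x : R), derivable (derive1n n f) x 1.

Definition test_function f :=
  smooth f /\ compact (closure [set x | f x != 0]).

Definition growth_at_infty (m : nat) g :=
  exists C M : R, forall x, M <= `|x| -> `|g x| <= C * `|x| ^+ m.

(* The exponent [m] may depend on the order [n] of the derivative. *)
Definition derivatives_poly_growth g :=
  forall n : nat, (0 < n)%N -> exists m, growth_at_infty m (derive1n n g).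

Definition abs_continuous_on (a b : R) f :=
  forall e : R, 0 < e -> exists2 d : R, 0 < d &
    forall (n : nat) (s t : 'I_n -> R),
      (forall i, [/\ a <= s i, s i <= t i & t i <= b]) ->
      trivIset [set: 'I_n] (fun i => `]s i, t i[%classic) ->
      \sum_(i < n) (t i - s i) < d ->
      \sum_(i < n) `|f (t i) - f (s i)| < e.

(* On the line, absolute continuity is understood on every compact interval.
   Such an [f] is differentiable Lebesgue-almost everywhere; [derive1 f] takes
   the value 0 at the remaining points. *)
Definition abs_continuous f := forall a b : R, abs_continuous_on a b f.

End functions.

Section measures.
Context {R : realType}.
Variable mu : probability (measurableTypeR R) R.
Implicit Types g v d : R -> R.
Local Open Scope ereal_scope.

(* Extended-real valued: for [g] nonnegative and [mu]-integrable, the first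
   term is well defined but possibly [+oo]; [0 log 0 = 0] holds in both terms
   because [0 * _ = 0]. *)
Definition entropy g : \bar R :=
  'E_mu[fun x => (g x * ln (g x))%R] - 'E_mu[g] * lne 'E_mu[g].

Definition is_log_gradient v :=
  mu.-integrable setT (EFin \o v) /\
  forall f : R -> R, test_function f ->
    'E_mu[derive1 f] = - 'E_mu[fun x => (v x * f x)%R].

(* The left-hand side of the duality is required to be a genuine integral. *)
Definition is_divergence g d :=
  mu.-integrable setT (EFin \o d) /\
  forall f : R -> R, test_function f ->
    mu.-integrable setT (EFin \o (fun x => (derive1 f x * g x)%R)) /\
    'E_mu[fun x => (derive1 f x * g x)%R] = 'E_mu[fun x => (f x * d x)%R].

End measures.

(* Main.v *)
Require Import Defs.
From HB Require Import structures.
From mathcomp Require Import all_boot all_order all_algebra.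
From mathcomp Require Import all_classical all_reals all_analysis.
From mathcomp Require Import measurable_realfun ring lra.

Set Implicit Arguments.
Unset Strict Implicit.
Unset Printing Implicit Defensive.

Import Order.TTheory GRing.Theory Num.Theory.
Import numFieldNormedType.Exports.

Local Open Scope classical_set_scope.
Local Open Scope ring_scope.

(* The statement is one-dimensional, and the substitution dy = dx / K turns it
   into a logarithmic Sobolev inequality for a density e^-V with
   V'' = K v' >= alpha, which follows from monotone transport (as in
   Cordero-Erausquin's proof for the Gaussian measure).  In the variable x:
   K never vanishes (say K > 0), so v_mu = (a - 2 K K') / K^2 is smooth, mu has
   a smooth density p > 0 with p' = v_mu p, the relation v = - K v_mu - K' holds
   everywhere, and k := K p satisfies k' = - v p.  Let phi' = 1 / K and g = f^2,
   of mu-integral m.  Let T be the increasing map which pushes g mu / m to mu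
   conditioned to [-n, n], an interval of mass Z, and let
   theta = phi o T - phi.  Convexity of - ln k in the variable phi together with
   ln q <= q - 1 gives
     g p ln (g / m) + g p ln Z - (2 / alpha) p (K f')^2 <= (k g theta)'.
   As theta is bounded, k g theta vanishes where f does; integrate, and let
   n tend to infinity (so that Z tends to 1).  For the corollary, f is
   multiplied by a cutoff chi (x / n); absolutely continuous functions are
   handled by representing the total variation as the integral of a
   Radon-Nikodym density. *)

(** The constant 2 / alpha comes from completing a square. Convexity contributes - (alpha / 2)
    theta^2 f^2, the factor g = f^2 in (k g theta)' contributes the cross term 2 K f f' theta, and
    alpha / 2 (theta f + (2 / alpha) K f')^2 absorbs both at the price (2 / alpha) (K f')^2. The
    entropy enters through the Jacobian equation T' p(T) = Z g p / m: it turns ln (g / m) + ln Z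
    into ln q + ln k(T) - ln k, where q = K T' / K(T) is the slope of T in the variable phi. The
    density comes from an integrating factor: if Q' = v_mu, then e^-Q mu has zero distributional
    derivative, so it is a multiple of Lebesgue measure. The corollary shapes the analytic part.
    Truncation preserves absolute continuity but gives no smoothness, so the transport argument must
    run for absolutely continuous f. Then k g theta is itself only absolutely continuous, and
    integrating its derivative requires the fundamental theorem of calculus for that class. *)

Section scalar_derivatives.
Context {R : realType}.
Implicit Types (f g : R -> R) (x df dg : R).

(** These rules keep functions in pointwise form and derivatives as plain products, so that a
    composed derivative can be matched with the claimed one by [ring] or [field]. *)
Lemma is_derive_add f g x df dg : is_derive x 1 f df -> is_derive x 1 g dg ->
  is_derive x 1 (fun y => f y + g y) (df + dg).
Proof. by move=> Df Dg; exact: is_deriveD. Qed.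

Lemma is_derive_opp f x df : is_derive x 1 f df ->
  is_derive x 1 (fun y => - f y) (- df).
Proof. by move=> Df; exact: is_deriveN. Qed.

Lemma is_derive_sub f g x df dg : is_derive x 1 f df -> is_derive x 1 g dg ->
  is_derive x 1 (fun y => f y - g y) (df - dg).
Proof. by move=> Df Dg; apply: is_derive_add => //; exact: is_derive_opp. Qed.

Lemma is_derive_mul f g x df dg : is_derive x 1 f df -> is_derive x 1 g dg ->
  is_derive x 1 (fun y => f y * g y) (df * g x + f x * dg).
Proof.
move=> Df Dg; have := is_deriveM Df Dg; rewrite /GRing.scale/= addrC.
by rewrite [g x * df]mulrC.
Qed.

Lemma is_derive_comp f g x df dg : is_derive (g x) 1 f df ->
  is_derive x 1 g dg -> is_derive x 1 (fun y => f (g y)) (df * dg).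
Proof.
move=> Df Dg; have := @is_derive1_comp R f g x df dg Df Dg; rewrite ?(mulrC dg); exact.
Qed.

Lemma is_derive_inv f x df : f x != 0 -> is_derive x 1 f df ->
  is_derive x 1 (fun y => (f y)^-1) (- df / f x ^+ 2).
Proof.
move=> fx0 Df; apply: (is_derive_eq (is_deriveV fx0 Df)).
by rewrite /GRing.scale/= mulNr mulrC mulNr.
Qed.

Lemma is_derive_exp f x df : is_derive x 1 f df ->
  is_derive x 1 (fun y => expR (f y)) (df * expR (f x)).
Proof.
by move=> Df; rewrite mulrC; apply: is_derive_comp; exact: is_derive_expR.
Qed.

Lemma is_derive_log f x df : 0 < f x -> is_derive x 1 f df ->
  is_derive x 1 (fun y => ln (f y)) (df / f x).
Proof.
move=> fx Df; rewrite mulrC; apply: is_derive_comp; exact: is_derive1_ln.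
Qed.

Lemma is_derive_sqr f x df : is_derive x 1 f df ->
  is_derive x 1 (fun y => f y ^+ 2) (2 * f x * df).
Proof.
move=> Df; have := is_derive_mul Df Df.
by rewrite (_ : df * f x + f x * df = 2 * f x * df)//; ring.
Qed.

Lemma is_derive_pow f x df n : is_derive x 1 f df ->
  is_derive x 1 (fun y => f y ^+ n) (n%:R * f x ^+ n.-1 * df).
Proof. by move=> Df; have := is_deriveX n Df; rewrite exprfctE. Qed.

End scalar_derivatives.

(** * Smooth functions and test functions *)

Section smooth_functions.
Context {R : realType}.
Implicit Types (f g df : R -> R).

(** A finite order allows induction: the derivatives of a product, of [expR \o f] and of 1 / f
    involve these functions again, already handled at the previous order. *)
Definition smoothn (n : nat) f :=
  forall k, (k <= n)%N -> forall x : R, derivable (derive1n k f) x 1.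

Lemma smoothP f : smooth f <-> forall n, smoothn n f.
Proof. by split=> [sf n k _ x|sf n x]; [exact: sf|exact: sf]. Qed.

Lemma derive1_is_derive f df : (forall x : R, is_derive x 1 f (df x)) ->
  derive1 f = df.
Proof. by move=> fdf; apply/funext => x; rewrite derive1E derive_val. Qed.

Lemma derivable_is_derive f (x : R) : derivable f x 1 -> is_derive x 1 f (derive1 f x).
Proof. by move=> /derivableP; rewrite -derive1E. Qed.

Lemma smoothn0 f df : (forall x : R, is_derive x 1 f (df x)) -> smoothn 0 f.
Proof. by move=> fdf [|//] _ x; rewrite derive1n0; exact: ex_derive. Qed.

Lemma smoothnS n f df : (forall x : R, is_derive x 1 f (df x)) -> smoothn n df ->
  smoothn n.+1 f.
Proof.
move=> fdf sdf [_ x|k kn x]; first by rewrite derive1n0; exact: ex_derive.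
rewrite /derive1n iterSr -/(derive1n k (derive1 f)) (derive1_is_derive fdf).
exact: sdf.
Qed.

Lemma smoothn_is_derive n f (x : R) : smoothn n f -> is_derive x 1 f (derive1 f x).
Proof. by move=> /(_ 0%N (leq0n _) x); exact: derivable_is_derive. Qed.

Lemma smoothn_derive1 n f : smoothn n.+1 f -> smoothn n (derive1 f).
Proof. by move=> sf k kn x; have := sf k.+1 kn x; rewrite /derive1n iterSr. Qed.

Lemma smoothn_le m n f : (m <= n)%N -> smoothn n f -> smoothn m f.
Proof. by move=> mn sf k km; apply: sf; exact: leq_trans mn. Qed.

Lemma smooth_is_derive f (x : R) : smooth f -> is_derive x 1 f (derive1 f x).
Proof. by move=> /(_ 0%N x); exact: derivable_is_derive. Qed.

Lemma smooth_derive1 f : smooth f -> smooth (derive1 f).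
Proof. by move=> sf n x; have := sf n.+1 x; rewrite /derive1n iterSr. Qed.

Lemma smooth_antiderivative f df : (forall x : R, is_derive x 1 f (df x)) ->
  smooth df -> smooth f.
Proof.
by move=> fdf /smoothP sdf; apply/smoothP => -[|n]; [exact: smoothn0 fdf|exact: smoothnS (sdf n)].
Qed.

Lemma is_derive_continuous f df : (forall x : R, is_derive x 1 f (df x)) ->
  continuous f.
Proof.
move=> fdf x; apply: differentiable_continuous.
by apply/derivable1_diffP; exact: ex_derive.
Qed.

Lemma smooth_continuous f : smooth f -> continuous f.
Proof. by move=> sf; apply: is_derive_continuous => x; exact: smooth_is_derive. Qed.

Lemma smoothn_cst n (c : R) : smoothn n (cst c).
Proof.
by elim: n c => [|n IH] c; [apply: smoothn0|apply: smoothnS (IH 0)] => x; exact: is_derive_cst.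
Qed.

Lemma smoothnD n f g : smoothn n f -> smoothn n g -> smoothn n (f \+ g).
Proof.
elim: n f g => [|n IH] f g sf sg.
  by apply: smoothn0 => x; apply: is_deriveD; [exact: smoothn_is_derive sf|exact: smoothn_is_derive sg].
apply: (smoothnS (df := derive1 f \+ derive1 g)).
  by move=> x; apply: is_deriveD; [exact: smoothn_is_derive sf|exact: smoothn_is_derive sg].
by apply: IH; exact: smoothn_derive1.
Qed.

Lemma smoothnM n f g : smoothn n f -> smoothn n g -> smoothn n (f \* g).
Proof.
have D m f1 g1 (sf : smoothn m f1) (sg : smoothn m g1) (x : R) :
    is_derive x 1 (f1 \* g1) ((derive1 f1 \* g1 \+ f1 \* derive1 g1) x).
  have df := smoothn_is_derive x sf; have dg := smoothn_is_derive x sg.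
  apply: (is_derive_eq (is_derive_mul df dg)).
  by rewrite /=.
elim: n f g => [|n IH] f g sf sg; first exact: smoothn0 (D _ _ _ sf sg).
apply: smoothnS (D _ _ _ sf sg) _.
apply: smoothnD; apply: IH => //; [|exact: smoothn_le sg|exact: smoothn_le sf|];
  exact: smoothn_derive1.
Qed.

Lemma smoothn_expR n f : smoothn n f -> smoothn n (expR \o f).
Proof.
have D m f1 (sf : smoothn m f1) (x : R) :
    is_derive x 1 (expR \o f1) ((derive1 f1 \* (expR \o f1)) x).
  have df := smoothn_is_derive x sf.
  apply: (is_derive_eq (is_derive_exp df)).
  by [].
elim: n f => [|n IH] f sf; first exact: smoothn0 (D _ _ sf).
apply: smoothnS (D _ _ sf) _.
by apply: smoothnM; [exact: smoothn_derive1|apply/IH/(smoothn_le _ sf)].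
Qed.

Lemma smoothn_inv n f : (forall x, f x != 0) -> smoothn n f ->
  smoothn n (fun x => (f x)^-1).
Proof.
move=> f0; set g := fun x => (f x)^-1.
have D m (sf : smoothn m f) (x : R) :
    is_derive x 1 g ((cst (- 1) \* derive1 f \* (g \* g)) x).
  have df := smoothn_is_derive x sf.
  apply: (is_derive_eq (is_derive_inv (f0 x) df)).
  by rewrite /= /g; field.
elim: n => [|n IH] sf; first exact: smoothn0 (D _ sf).
apply: smoothnS (D _ sf) _.
have sg := IH (smoothn_le (leqnSn _) sf).
apply: smoothnM; last exact: smoothnM.
by apply: smoothnM; [exact: smoothn_cst|exact: smoothn_derive1].
Qed.

Lemma smoothn_affine n f (c d : R) : smoothn n f -> smoothn n (fun x => f (c * x + d)).
Proof.
have D m f1 (sf : smoothn m f1) (x : R) :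
    is_derive x 1 (fun x => f1 (c * x + d)) ((cst c \* (fun x => derive1 f1 (c * x + d))) x).
  have df := smoothn_is_derive (c * x + d) sf.
  have dl : is_derive x 1 (fun y : R => c * y + d) (0 * x + c * 1 + 0).
    by apply: is_derive_add; apply: is_derive_mul.
  by apply: (is_derive_eq (@is_derive_comp _ f1 (fun y => c * y + d) x _ _ df dl)); rewrite /=; ring.
elim: n f => [|n IH] f sf; first exact: smoothn0 (D _ _ sf).
apply: smoothnS (D _ _ sf) _.
by apply: smoothnM; [exact: smoothn_cst|apply/IH/smoothn_derive1].
Qed.

End smooth_functions.

(** * Smooth bumps built from exp(-1/x) *)

Section bump_functions.
Context {R : realType}.
Implicit Types (f g : R -> R).

(** Writing e^y as the power of order m + 1 of e^(y / (m + 1)), which exceeds y / (m + 1), gives an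
    explicit constant. *)
Lemma exprM_expRN_bounded (m : nat) (y : R) : 0 <= y ->
  y ^+ m.+1 * expR (- y) <= m.+1%:R ^+ m.+1.
Proof.
move=> y0; rewrite expRN ler_pdivrMr ?expR_gt0//.
have -> : expR y = expR (y / m.+1%:R) ^+ m.+1.
  by rewrite -expRM_natl mulrCA divff ?mulr1 ?pnatr_eq0.
rewrite -exprMn ler_pXn2r// ?nnegrE ?mulr_ge0 ?expR_ge0//.
rewrite -ler_pdivrMl// mulrC (le_trans _ (expR_ge1Dx _))//.
by rewrite lerDr.
Qed.

(** exp(-1/x) extended by 0, times the powers of 1/x that its successive derivatives produce. *)
Definition flat (j : nat) (x : R) : R :=
  if 0 < x then x^-1 ^+ j * expR (- x^-1) else 0.

Lemma flat_ge0 j x : 0 <= flat j x.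
Proof.
by rewrite /flat; case: ifPn => // x0; rewrite mulr_ge0 ?expR_ge0 ?exprn_ge0 ?invr_ge0 ?ltW.
Qed.

Lemma flatS j x : flat j x = flat j.+1 x * x.
Proof.
rewrite /flat; case: ifPn => [x0|_]; last by rewrite mul0r.
by rewrite exprS; field; rewrite gt_eqF.
Qed.

Lemma flat_le j x : flat j x <= j.+1%:R ^+ j.+1 * `|x|.
Proof.
rewrite flatS /flat; case: ifPn => [x0|_]; last by rewrite mul0r mulr_ge0 ?exprn_ge0.
by rewrite gtr0_norm// ler_pM2r// exprM_expRN_bounded// invr_ge0 ltW.
Qed.

Lemma is_derive_flat j (x : R) :
  is_derive x 1 (flat j) (- j%:R * flat j.+1 x + flat j.+2 x).
Proof.
have [x0|x0|->] := ltgtP x 0.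
- have -> : - j%:R * flat j.+1 x + flat j.+2 x = 0.
    by rewrite /flat ltNge (ltW x0)/= mulr0 addr0.
  apply: (@near_eq_is_derive _ _ _ (cst 0)).
  near=> y; rewrite /flat ltNge ltW//=.
  by near: y; exact: lt_nbhsl.
- apply: (@near_eq_is_derive _ _ _ (fun y : R => y^-1 ^+ j * expR (- y^-1))).
    near=> y; rewrite /flat ifT//.
    by near: y; exact: lt_nbhsr.
  have x0' : x != 0 by rewrite gt_eqF.
  have Di : is_derive x 1 (fun y : R => y^-1) (- 1 / x ^+ 2) by exact: is_derive_inv.
  have De := is_derive_exp (is_derive_opp Di).
  have := is_derive_mul (is_derive_pow j Di) De.
  move=> D; apply: (is_derive_eq D).
  rewrite /flat x0; case: j {D} => [|j] /=; first by rewrite !expr0 !expr2; field.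
  by rewrite !exprS; field.
- have -> : - j%:R * flat j.+1 0 + flat j.+2 0 = 0.
    by rewrite /flat ltxx mulr0 addr0.
  (* Since [flat j z = flat j.+1 z * z], the slope from 0 is [flat j.+1]; its continuity at 0 is the
     linear bound [flat_le]. *)
  apply/is_derive1_caratheodory; exists (flat j.+1).
  have f0 k : flat k 0 = 0 by rewrite /flat ltxx.
  split; [by move=> z; rewrite f0 !subr0 -flatS| |by rewrite f0].
  apply/cvgrPdist_le => e e0; near=> z.
  rewrite f0 sub0r normrN ger0_norm ?flat_ge0//.
  apply: (le_trans (flat_le _ _)).
  rewrite mulrC -ler_pdivlMr ?exprn_gt0//.
  near: z; apply: cvgr0_norm_le; [exact: cvg_id|by rewrite divr_gt0// exprn_gt0].
Unshelve. all: by end_near. Qed.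

(* The family [flat] is closed under differentiation up to linear combinations. *)
Lemma smoothn_flat n j : smoothn n (flat j).
Proof.
elim: n j => [|n IH] j; first exact: smoothn0 (is_derive_flat j).
apply: smoothnS (is_derive_flat j) _.
by apply: smoothnD => //; apply: smoothnM => //; exact: smoothn_cst.
Qed.

(** The factor [n.+1] sharpens the edges: as n grows the bumps tend to the indicator of the open
    interval from p to q, while each stays positive on all of it. *)
Definition bump (p q : R) (n : nat) (x : R) : R :=
  flat 0 (n.+1%:R * (x - p)) * flat 0 (n.+1%:R * (q - x)).

Lemma flat0_le1 x : flat 0 x <= 1.
Proof.
rewrite /flat; case: ifPn => // x0; rewrite expr0 mul1r -expR0 ler_expR.
by rewrite oppr_le0 invr_ge0 ltW.
Qed.

Lemma bump_ge0 p q n x : 0 <= bump p q n x.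
Proof. by rewrite mulr_ge0// flat_ge0. Qed.

Lemma bump_le1 p q n x : bump p q n x <= 1.
Proof. by rewrite /bump -[leRHS]mul1r ler_pM ?flat_ge0 ?flat0_le1. Qed.

Lemma bump_eq0 p q n x : ~~ (p < x < q) -> bump p q n x = 0.
Proof.
rewrite negb_and -!leNgt /bump /flat => /orP[xp|qx].
  by rewrite ifF ?mul0r//; apply/negbTE; rewrite -leNgt pmulr_rle0// subr_le0.
by rewrite [X in _ * X]ifF ?mulr0//; apply/negbTE; rewrite -leNgt pmulr_rle0// subr_le0.
Qed.

Lemma bump_gt0 p q n x : p < x < q -> 0 < bump p q n x.
Proof.
move=> /andP[px xq]; rewrite /bump /flat !ifT ?mulr_gt0 ?expR_gt0 ?exprn_gt0//
  ?invr_gt0// ?mulr_gt0// subr_gt0//.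
Qed.

Lemma cvg_flat0 (c : R) : 0 < c -> flat 0 (n.+1%:R * c) @[n --> \oo] --> (1 : R).
Proof.
move=> c0.
have -> : (fun n => flat 0 (n.+1%:R * c)) = (fun n => expR (- (n.+1%:R^-1 * c^-1))).
  apply/funext => n; rewrite /flat ifT ?mulr_gt0// expr0 mul1r invfM//.
rewrite -[X in _ --> X]expR0; apply: continuous_cvg; first exact: continuous_expR.
have H : (fun n => n.+1%:R^-1 * c^-1) @ \oo --> 0 * c^-1.
  by apply: cvgM; [exact: cvg_harmonic|exact: cvg_cst].
by rewrite -oppr0; apply: cvgN; rewrite mul0r in H.
Qed.

Lemma cvg_bump p q x : p < x < q -> bump p q n x @[n --> \oo] --> (1 : R).
Proof.
move=> /andP[px xq]; rewrite -[1]mulr1; apply: cvgM; apply: cvg_flat0; rewrite subr_gt0//.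
Qed.

Lemma smooth_bump p q n : smooth (bump p q n).
Proof.
apply/smoothP => k.
have -> : bump p q n = (fun x => flat 0 (n.+1%:R * x + (- n.+1%:R * p))) \*
   (fun x => flat 0 (- n.+1%:R * x + n.+1%:R * q)).
  by apply/funext => x; rewrite /bump/=; congr (flat _ _ * flat _ _); ring.
by apply: smoothnM; apply: smoothn_affine; exact: smoothn_flat.
Qed.

Lemma test_functionP f : test_function f <->
  smooth f /\ exists2 M : R, 0 < M & forall x, ~~ (- M < x < M) -> f x = 0.
Proof.
split=> [[sf cf]|[sf [M M0 fM]]]; split => //.
  have [M [_ HM]] := compact_bounded cf.
  have M1 : M < `|M| + 1 by rewrite ltr_pwDr// ler_norm.
  exists (`|M| + 2) => [|x xM]; first by rewrite ltr_wpDl.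
  apply: contrapT => /eqP fx0.
  have := HM _ M1 x (@subset_closure _ [set x | f x != 0] x fx0).
  rewrite /= ler_norml => /andP[x1 x2]; case/negP : xM; apply/andP; split; lra.
apply: (@subclosed_compact _ _ `[- M, M]%classic).
- exact: closed_closure.
- exact: segment_compact.
- rewrite [X in _ `<=` X](closure_id _).1; last exact: itv_closed.
  apply: closure_subset => y /= fy; rewrite in_itv/=; apply/negPn/negP => yM.
  move/negP: fy; apply; apply/eqP/fM; apply: contra yM => /andP[? ?].
  by rewrite !ltW.
Qed.

Lemma test_bump p q n : test_function (bump p q n).
Proof.
apply/test_functionP; split; first exact: smooth_bump.
exists (1 + `|p| + `|q|); first by rewrite -addrA ltr_pwDl// addr_ge0.
move=> x xM; apply: bump_eq0; apply: contra xM.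
have := ler_norm (- p); have := ler_norm p.
have := ler_norm (- q); have := ler_norm q; rewrite !normrN; lra.
Qed.

Lemma testM f g : test_function f -> smooth g -> test_function (f \* g).
Proof.
move=> /test_functionP[sf [M M0 fM]] sg; apply/test_functionP; split.
  by move/smoothP : sf => sf; move/smoothP : sg => sg; apply/smoothP => n; exact: smoothnM.
by exists M => // x /fM fx; rewrite /= fx mul0r.
Qed.

End bump_functions.

(** * Absolutely continuous functions *)

Section variation_of_abs_continuous.
Context {R : realType}.
Implicit Types (a b : R) (f : R -> R).

(** Refining intervals by partitions yields a family indexed by dependent pairs; allowing any finite
    index type spares its renumbering. *)
Lemma abs_continuous_on_fin a b f : abs_continuous_on a b f ->
  forall e : R, 0 < e -> exists2 d : R, 0 < d &
    forall (I : finType) (s t : I -> R),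
      (forall i, [/\ a <= s i, s i <= t i & t i <= b]) ->
      (forall i j, i != j -> [disjoint `]s i, t i[ & `]s j, t j[]%classic) ->
      \sum_i (t i - s i) < d -> \sum_i `|f (t i) - f (s i)| < e.
Proof.
move=> acf e e0; have [d d0 H] := acf e e0; exists d => // I s t st dis std.
have sumE (F : I -> R) : \sum_i F i = \sum_(i < #|I|) F (enum_val i).
  by rewrite (reindex _ (onW_bij _ (@enum_val_bij I))).
rewrite (sumE (fun i => `|f (t i) - f (s i)|)); apply: (H _ (s \o enum_val) (t \o enum_val)).
- by move=> i; exact: st.
- apply/trivIsetP => i j _ _ ij; apply/disj_set2P/dis.
  by apply: contra_neq ij => /enum_val_inj.
- by rewrite -(sumE (fun i => t i - s i)).
Qed.

Lemma itv_partition_nth_homo a b l : itv_partition a b l ->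
  forall i j, (i <= j)%N -> (j <= size l)%N ->
  nth b (a :: l) i <= nth b (a :: l) j.
Proof.
move=> [pl _] i j ij jl.
have sl : sorted <=%O (a :: l).
  by rewrite /=; apply: sub_path pl => x y /ltW.
have := sorted_leq_nth le_trans lexx b sl.
by apply => //; rewrite inE/= ltnS// (leq_trans ij).
Qed.

(* Disjointness of the refined family: pieces of one partition are ordered,
   pieces of different partitions sit in disjoint intervals. *)
Lemma abs_continuous_on_variation a b f : abs_continuous_on a b f ->
  forall e : R, 0 < e -> exists2 d : R, 0 < d &
    forall (n : nat) (s t : 'I_n -> R) (l : 'I_n -> seq R),
      (forall i, [/\ a <= s i, s i <= t i & t i <= b]) ->
      trivIset [set: 'I_n] (fun i => `]s i, t i[%classic) ->
      \sum_(i < n) (t i - s i) < d ->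
      (forall i, itv_partition (s i) (t i) (l i)) ->
      \sum_(i < n) variation (s i) (t i) f (l i) < e.
Proof.
move=> /abs_continuous_on_fin acf e e0.
have [d d0 H] := acf e e0; exists d => // n s t l st dis std lp.
pose I := {i : 'I_n & 'I_(size (l i))}.
pose F i j := nth (t i) (s i :: l i) j.
have Fhomo i := itv_partition_nth_homo (lp i).
pose S (x : I) := F (tag x) (tagged x); pose T (x : I) := F (tag x) (tagged x).+1.
have sumE (g : forall i : 'I_n, nat -> R) :
    \sum_(i < n) \sum_(0 <= j < size (l i)) g i j =
    \sum_(x : I) g (tag x) (tagged x).
  under eq_bigr do rewrite big_mkord.
  by rewrite sig_big_dep.
have sF i : s i = F i 0%N by [].
have tF i : t i = F i (size (l i)).
  by rewrite /F (itv_partition_nth_size (t i) (lp i)).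
rewrite (sumE (fun i j => `|f (F i j.+1) - f (F i j)|)).
apply: (H I S T).
- move=> [i j]; rewrite /S /T/=; split.
  + have [ai _ _] := st i; apply: (le_trans ai).
    by rewrite sF; apply: Fhomo => //; exact: ltnW.
  + by apply: Fhomo.
  + have [_ _ bi] := st i; apply: le_trans bi.
    by rewrite tF; apply: Fhomo.
- move=> [i j] [i' j'] neq; rewrite /S /T/=.
  apply/disj_set2P/seteqP; split => // x [] /=; rewrite !in_itv/=.
  move=> /andP[Fx xF] /andP[Fx' xF'].
  have [ii'|ii'] := eqVneq i i'; last first.
    have /trivIsetP/(_ i i' Logic.I Logic.I ii') := dis.
    move=> /seteqP[+ _] => /(_ x); apply; rewrite /= !in_itv/=; split.
      rewrite sF tF (le_lt_trans _ Fx)/=; last first.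
        by apply: Fhomo => //; exact: ltnW.
      by apply: (lt_le_trans xF); apply: Fhomo.
    rewrite sF tF (le_lt_trans _ Fx')/=; last first.
      by apply: Fhomo => //; exact: ltnW.
    by apply: (lt_le_trans xF'); apply: Fhomo.
  subst i'.
  have [jj'|jj'|jj'] := ltngtP j j'.
  + have := lt_trans Fx' xF; rewrite ltNge => /negP; apply.
    by apply: Fhomo => //; exact: ltnW.
  + have := lt_trans Fx xF'; rewrite ltNge => /negP; apply.
    by apply: Fhomo => //; exact: ltnW.
  + by move/eqP: neq; apply; congr existT; exact: val_inj.
- rewrite -(sumE (fun i j => F i j.+1 - F i j)).
  under eq_bigr => i _ do rewrite telescope_sumr// -sF -tF.
  by [].
Qed.

End variation_of_abs_continuous.

(** * Densities of absolutely continuous monotone functions *)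

Section density_of_abs_increasing.
Context {R : realType}.
Implicit Types (a b : R) (f : R -> R).
Notation TV := total_variation.
Notation lambda := (@lebesgue_measure R).

(** The bound is uniform over partitions, so it passes to the suprema that define the total
    variations; the strict inequality becomes a weak one. *)
Lemma abs_continuous_on_total_variation a b f : abs_continuous_on a b f ->
  forall e : R, 0 < e -> exists2 d : R, 0 < d &
    forall (n : nat) (s t : 'I_n -> R),
      (forall i, [/\ a <= s i, s i <= t i & t i <= b]) ->
      trivIset [set: 'I_n] (fun i => `]s i, t i[%classic) ->
      \sum_(i < n) (t i - s i) < d ->
      (\sum_(i < n) TV (s i) (t i) f <= e%:E)%E.
Proof.
move=> /abs_continuous_on_variation acf e e0.
have [d d0 H] := acf e e0; exists d => // n s t st dis std.
have TVfin i : TV (s i) (t i) f \is a fin_num.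
  have [ai si bi] := st i.
  rewrite ge0_fin_numE ?total_variation_ge0//.
  apply: (@le_lt_trans _ _ e%:E); last exact: ltry.
  apply: ge_ereal_sup => _ [_ [l lp <-] <-]; rewrite lee_fin.
  have := H 1%N (fun=> s i) (fun=> t i) (fun=> l).
  rewrite !big_ord1 => /(_ _ _ _ _)/ltW; apply => //.
    by apply/trivIsetP => j k _ _; rewrite !ord1 eqxx.
  apply: le_lt_trans std; rewrite (bigD1 i)//= lerDl sumr_ge0// => j _.
  by rewrite subr_ge0; have [] := st j.
apply/lee_addgt0Pr => eta eta0.
(* A nearly optimal partition of each interval loses at most eta / (n + 1), hence at most eta in
   total; [n.+1] also covers the empty family. *)
have eta' : 0 < eta / n.+1%:R by rewrite divr_gt0.
have /choice[l Hl] i : exists l, itv_partition (s i) (t i) l /\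
    (TV (s i) (t i) f <= (variation (s i) (t i) f l + eta / n.+1%:R)%:E)%E.
  have [_ [_ [l lp <-] <-]] := ub_ereal_sup_adherent eta' (TVfin i).
  by rewrite lteBlDr// => /ltW h; exists l; split.
apply: (@le_trans _ _ (\sum_(i < n)
    (variation (s i) (t i) f (l i) + eta / n.+1%:R)%:E)%E).
  by apply: lee_sum => i _; have [] := Hl i.
rewrite sumEFin -EFinD lee_fin big_split/= lerD//.
  by apply/ltW/H => // i; have [] := Hl i.
rewrite sumr_const card_ord -[(eta / _) *+ n]mulr_natr -mulrA ler_piMr ?(ltW eta0)//.
by rewrite mulrC ler_pdivrMr// mul1r ler_nat.
Qed.

(** An interval shorter than d has variation at most 1, and finitely many steps of length d / 2
    reach b from a. *)
Lemma abs_continuous_on_bounded_variation a b f : a <= b ->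
  abs_continuous_on a b f -> TV a b f \is a fin_num.
Proof.
move=> ab /abs_continuous_on_total_variation/(_ 1 ltr01)[d d0 H].
have TV1 x y : a <= x -> x <= y -> y <= b -> y - x < d -> (TV x y f < +oo)%E.
  move=> ax xy yb yxd; have := H 1%N (fun=> x) (fun=> y).
  rewrite !big_ord1 => /(_ _ _ _)/le_lt_trans; apply => //; last exact: ltry.
  by apply/trivIsetP => j k _ _; rewrite !ord1 eqxx.
have d20 : 0 < d / 2 by rewrite divr_gt0.
suff S n x : a <= x -> x <= b -> x <= a + (d / 2) *+ n -> (TV a x f < +oo)%E.
  rewrite ge0_fin_numE ?total_variation_ge0//.
  pose n := (Num.truncn ((b - a) / (d / 2))).+1.
  apply: (S n) => //; rewrite -lerBlDl -[_ *+ _]mulr_natl -ler_pdivrMr//.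
  exact/ltW/truncnS_gt.
elim: n x => [|n IH] x ax xb.
  rewrite mulr0n addr0 => xa; have -> : x = a by apply/eqP; rewrite eq_le xa.
  by rewrite total_variationxx.
rewrite mulrSr addrA => xn.
have [xan|xan] := leP x (a + d / 2 *+ n); first exact: IH.
have ay : a <= a + d / 2 *+ n by rewrite lerDl mulrn_wge0// ltW.
rewrite (total_variationD f ay (ltW xan)); apply: lte_add_pinfty.
  by apply: IH => //; rewrite (le_trans (ltW xan)).
by apply: TV1 => //; [exact: ltW|lra].
Qed.

(** Absolute continuity over the whole line at once, meant for nondecreasing functions; the final
    inequality is weak because bounds on total variation provide no more. *)
Definition abs_increasing (G : R -> R) := forall e : R, 0 < e ->
  exists2 d : R, 0 < d & forall (n : nat) (s t : 'I_n -> R),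
    (forall i, s i <= t i) ->
    trivIset [set: 'I_n] (fun i => `]s i, t i[%classic) ->
    \sum_(i < n) (t i - s i) < d -> \sum_(i < n) (G (t i) - G (s i)) <= e.

(** Finite length bounds the interval on both sides, since it contains every segment between two of
    its points; its endpoints are then [inf A] and [sup A]. *)
Lemma open_is_interval_itv (A : set R) : open A -> is_interval A ->
  (lambda A < +oo)%E -> exists s t, s <= t /\ A = `]s, t[%classic.
Proof.
move=> oA iA Afin.
have [->|/set0P [x0 Ax0]] := eqVneq A set0.
  by exists 0, 0; split => //; rewrite set_itvoo0.
have mA : measurable A by exact: open_measurable.
have big x y : A x -> A y -> x <= y -> ((y - x)%:E <= lambda A)%E.
  move=> Ax Ay xy; apply: (@le_trans _ _ (lambda `[x, y]%classic)).
    rewrite lebesgue_measure_itv/= lte_fin; case: ltP => //.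
    by move=> yx; rewrite lee_fin subr_le0.
  apply: le_measure; rewrite ?inE//.
  by move=> z/=; rewrite in_itv/=; exact: iA.
have Afine : lambda A \is a fin_num by rewrite ge0_fin_numE.
have ubA : has_ubound A.
  exists (x0 + fine (lambda A)) => y Ay.
  have [xy|/ltW yx] := leP x0 y; last by rewrite (le_trans yx)// lerDl fine_ge0.
  by rewrite -lerBlDl -lee_fin fineK// big.
have lbA : has_lbound A.
  exists (x0 - fine (lambda A)) => y Ay.
  have [xy|/ltW yx] := leP x0 y; first by rewrite (le_trans _ xy)// gerBl fine_ge0.
  by rewrite lerBlDr -lerBlDl -lee_fin fineK// big.
exists (inf A), (sup A); split.
  by apply: (@le_trans _ _ x0); [exact: ge_inf|exact: ub_le_sup].
by rewrite -(interval_bounded_interior iA)//; move/interior_id : oA => ->.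
Qed.

Lemma abs_increasing_right_continuous (G : R -> R) :
  nondecreasing G -> abs_increasing G -> right_continuous G.
Proof.
move=> ndG acG x; apply/cvgrPdist_le => e e0.
have [d d0 H] := acG e e0.
near=> y.
have xy : x <= y by near: y; exact: nbhs_right_ge.
rewrite distrC ger0_norm ?subr_ge0 ?ndG//.
have := H 1%N (fun=> x) (fun=> y); rewrite !big_ord1; apply => //.
  by apply/trivIsetP => j k _ _; rewrite !ord1 eqxx.
by rewrite ltrBlDl; near: y; apply: nbhs_right_lt; rewrite ltrDl.
Unshelve. all: by end_near. Qed.

(** The density is the Radon-Nikodym derivative of the Stieltjes measure of [G], which the bounds at
    a and b make finite. Lebesgue measure dominates it: a null set lies in an open set of length
    less than d, whose components carry a total increment of at most e. *)
Lemma nondecreasing_abs_increasing_density (G : R -> R) a b :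
  nondecreasing G -> abs_increasing G ->
  (forall x, G a <= G x) -> (forall x, G x <= G b) ->
  exists2 h : R -> R, lambda.-integrable setT (EFin \o h) &
    forall x y, x <= y ->
      (G y - G x)%:E = (\int[lambda]_(z in `]x, y]) (h z)%:E)%E.
Proof.
move=> ndG acG Ga Gb.
pose C : cumulative R R := HB.pack G (isCumulative.Build R _ R G ndG
  (abs_increasing_right_continuous ndG acG)).
pose nu : {measure set (measurableTypeR R) -> \bar R} := lebesgue_stieltjes_measure C.
have nuE x y : x <= y -> nu `]x, y]%classic = (G y - G x)%:E.
  move=> xy; rewrite /nu/= /lebesgue_stieltjes_measure /measure_extension.
  by rewrite measurable_mu_extE/=; [rewrite wlength_itv_bnd|exact: is_ocitv].
have nufin : fin_num_fun nu.
  apply: lty_fin_num_fun; apply: (@le_lt_trans _ _ (G b - G a)%:E); last exact: ltry.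
  rewrite -(bigcup_itvT false false).
  have cv : nu (`](- n%:R), n%:R]%classic) @[n --> \oo] -->
      nu (\bigcup_n `](- n%:R), n%:R]%classic).
    apply: nondecreasing_cvg_mu => //; first exact: bigcup_measurable.
    by move=> *; apply/subsetPset/subset_itv; rewrite leBSide/= ?lerN2 ler_nat.
  rewrite -(cvg_lim _ cv)//; apply: lime_le; first by apply: cvgP; exact: cv.
  near=> n; rewrite nuE; last by rewrite ge0_cp.
  by rewrite lee_fin lerB.
have [nuf nufE] : exists nuf : {finite_measure set (measurableTypeR R) -> \bar R},
    (nuf : set _ -> \bar R) = nu.
  pose nuf : {finite_measure set (measurableTypeR R) -> \bar R} :=
    HB.pack (lebesgue_stieltjes_measure C)
      (Measure_isFinite.Build _ _ _ (lebesgue_stieltjes_measure C) nufin).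
  by exists nuf.
have dom : nuf `<< lambda.
  apply/null_content_dominatesP => A mA A0; rewrite nufE.
  apply/eqP; rewrite eq_le measure_ge0 andbT.
  apply/lee_addgt0Pr => e e0; rewrite add0e.
  have [d d0 H] := acG e e0.
  have Aoo : (lambda A < +oo)%E by rewrite A0.
  have [U [oU AU UA]] := lebesgue_regularity_outer mA Aoo d0.
  have Ud : (lambda U < d%:E)%E.
    have mU := open_measurable oU.
    have -> : U = A `|` (U `\` A) by rewrite setDUK.
    apply: le_lt_trans UA; apply: (le_trans (measureU2 _ _ _)) => //.
      exact: measurableD.
    by rewrite A0 add0e.
  pose J := open_disjoint_itv oU.
  have JU k : J k `<=` U by rewrite (open_disjoint_itv_bigcup oU); exact: bigcup_sup.
  have oJ k : open (J k) by exact: open_disjoint_itv_open.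
  have Joo k : (lambda (J k) < +oo)%E.
    apply: (@le_lt_trans _ _ (lambda U)); last exact: lt_trans Ud (ltry _).
    by apply: le_measure; rewrite ?inE; [exact: open_measurable..|].
  have /choice[s /choice[t st]] k : exists s t, s <= t /\ J k = `]s, t[%classic.
    apply: open_is_interval_itv => //; exact: open_disjoint_itv_is_interval.
  have tJ : trivIset setT J by exact: open_disjoint_itv_trivIset.
  apply: (@le_trans _ _ (nu U)).
    by apply: le_measure; rewrite ?inE//; exact: open_measurable.
  rewrite (open_disjoint_itv_bigcup oU) measure_bigcup//; last first.
    by move=> k _; exact: open_measurable.
  (* Absolute continuity speaks of finite families, so the components are summed up to n first. *)
  apply: lime_le; first exact: is_cvg_nneseries.
  near=> n; rewrite big_mkord.
  apply: (@le_trans _ _ (\sum_(k < n) (G (t k) - G (s k))%:E)%E).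
    rewrite (eq_bigl xpredT); last by move=> k; rewrite in_setT.
    apply: lee_sum => k _; rewrite -nuE; last by have [] := st k.
    apply: le_measure; rewrite ?inE//; first exact: open_measurable.
    by rewrite -/(J k); have [_ ->] := st k; exact: subset_itv_oo_oc.
  rewrite sumEFin lee_fin; apply: H => [k| |].
  - by have [] := st k.
  - apply/trivIsetP => i j _ _ ij.
    have [_ <-] := st i; have [_ <-] := st j.
    by move/trivIsetP : tJ => /(_ i j); apply.
  rewrite -lte_fin; apply: le_lt_trans Ud.
  have -> : (\sum_(i < n) (t i - s i))%:E = (\sum_(i < n) lambda (J i))%E.
    rewrite -sumEFin; apply: eq_bigr => k _; have [stk ->] := st k.
    rewrite lebesgue_measure_itv/= lte_fin.
    by move: stk; rewrite le_eqVlt => /predU1P[->|->//]; rewrite ltxx subrr.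
  rewrite -(@measure_semi_additive _ _ _ lambda J)//.
  - apply: le_measure; rewrite ?inE.
    + by apply: bigsetU_measurable => k _; exact: open_measurable.
    + exact: open_measurable.
    + by rewrite -bigcup_mkord => x [k _]; exact: JU.
  - by move=> k; exact: open_measurable.
  - by apply: bigsetU_measurable => k _; exact: open_measurable.
pose h := Radon_Nikodym (charge_of_finite_measure nuf) lambda.
have hfin x : h x \is a fin_num by exact: Radon_Nikodym_fin_num.
have hE : EFin \o (fine \o h) = h by apply/funext => x /=; rewrite fineK.
exists (fine \o h); first by rewrite hE; exact: Radon_Nikodym_integrable.
move=> x y xy; rewrite -nuE// -nufE.
under eq_integral do rewrite fineK//.
rewrite -Radon_Nikodym_integral//.
Unshelve. all: by end_near. Qed.
End density_of_abs_increasing.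

(** * The fundamental theorem of calculus for absolutely continuous functions *)

Section fundamental_theorem.
Context {R : realType}.
Implicit Types (a b : R) (f : R -> R).
Notation TV := total_variation.
Notation lambda := (@lebesgue_measure R).

(** Jordan decomposition: f is the difference of its variation function [P] and of [N], both
    nondecreasing and absolutely continuous, and each of them has a density. *)
Lemma abs_continuous_on_density a b f : a < b -> abs_continuous_on a b f ->
  exists2 h : R -> R, lambda.-integrable setT (EFin \o h) &
    forall x, a <= x <= b ->
      (f x - f a)%:E = (\int[lambda]_(z in `]a, x]) (h z)%:E)%E.
Proof.
move=> ab acf; have TVfin := abs_continuous_on_bounded_variation (ltW ab) acf.
(* Clamping to [a, b] makes [P] and [N] constant outside, hence monotone and bounded on the whole
   line. *)
pose c (x : R) := Num.max a (Num.min b x).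
have ca x : a <= c x by rewrite /c le_max lexx.
have cb x : c x <= b by rewrite /c ge_max (ltW ab)/= ge_min lexx.
have cid x : a <= x <= b -> c x = x.
  by move=> /andP[ax xb]; rewrite /c; rewrite (min_idPr xb) (max_idPr ax).
have ndc : {homo c : x y / x <= y}.
  move=> x y xy; rewrite {1}/c ge_max ca/= /c le_max; apply/orP; right.
  by rewrite le_min !ge_min lexx xy orbT.
have lipc x y : x <= y -> c y - c x <= y - x.
  move=> xy; rewrite lerBlDr {1}/c ge_max; apply/andP; split.
    by rewrite (le_trans (ca x))// lerDr subr_ge0.
  have : Num.min b x <= c x by rewrite /c le_max lexx orbT.
  rewrite ge_min => /orP[bc|xc].
    by rewrite ge_min; apply/orP; left; rewrite (le_trans bc)// lerDr subr_ge0.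
  by rewrite ge_min; apply/orP; right; rewrite -lerBlDl opprB addrC subrK.
have itvc x y z : c x < z < c y -> x < z < y.
  move=> /andP[xz zy]; apply/andP; split.
    move: xz; rewrite {1}/c gt_max gt_min => /andP[_ /orP[bz|//]].
    by have := lt_le_trans (lt_trans bz zy) (cb y); rewrite ltxx.
  move: zy; rewrite /c lt_max lt_min => /orP[za|/andP[]//].
  by have := lt_trans (le_lt_trans (ca x) xz) za; rewrite ltxx.
have TVcfin x y : x <= y -> TV (c x) (c y) f \is a fin_num.
  move=> xy; move: TVfin.
  rewrite (total_variationD f (ca y) (cb y)) fin_numD => /andP[+ _].
  by rewrite (total_variationD f (ca x) (ndc _ _ xy)) fin_numD => /andP[].
pose P x := fine (TV a (c x) f).
pose N x := P x - f (c x).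
have PE x y : x <= y -> P y - P x = fine (TV (c x) (c y) f).
  move=> xy; rewrite /P (total_variationD f (ca x) (ndc _ _ xy)).
  rewrite fineD ?TVcfin//; first by rewrite addrAC subrr add0r.
  by move: TVfin; rewrite (total_variationD f (ca x) (cb x)) fin_numD => /andP[].
have TVge x y : x <= y -> `|f (c y) - f (c x)| <= fine (TV (c x) (c y) f).
  by move=> xy; rewrite -lee_fin fineK ?TVcfin// total_variation_ge// ndc.
have ndP : nondecreasing P.
  by move=> x y xy; rewrite -subr_ge0 PE// (le_trans _ (TVge _ _ xy)).
have ndN : nondecreasing N.
  move=> x y xy; have := TVge _ _ xy; have := ler_norm (f (c y) - f (c x)).
  by rewrite -PE// /N; lra.
(* Increments of f are at most those of [P] in absolute value, so [N] inherits absolute continuity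
   from [P] taken at e / 2. *)
have NP x y : x <= y -> N y - N x <= 2 * (P y - P x).
  move=> xy; have := TVge _ _ xy; have := ler_norm (- (f (c y) - f (c x))).
  by rewrite -PE// normrN /N; lra.
have acP : abs_increasing P.
  move=> e e0; have [d d0 H] := abs_continuous_on_total_variation acf e0.
  exists d => // n s t st dis std.
  rewrite -lee_fin; apply: le_trans (H n (c \o s) (c \o t) _ _ _).
  - rewrite -sumEFin; apply: lee_sum => i _.
    by rewrite PE// fineK// TVcfin.
  - by move=> i /=; rewrite ca cb ndc.
  - apply/trivIsetP => i j _ _ ij; apply/seteqP; split => // z [] /=.
    rewrite !in_itv/= => /itvc zi /itvc zj.
    by move/trivIsetP : dis => /(_ i j Logic.I Logic.I ij)/seteqP[+ _] => /(_ z); apply.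
  - by apply: le_lt_trans std; apply: ler_sum => i _; exact: lipc.
have acN : abs_increasing N.
  move=> e e0; have e20 : 0 < e / 2 by rewrite divr_gt0.
  have [d d0 H] := acP _ e20; exists d => // n s t st dis std.
  apply: (@le_trans _ _ (2 * \sum_(i < n) (P (t i) - P (s i)))).
    by rewrite mulr_sumr; apply: ler_sum => i _; exact: NP.
  by rewrite mulrC -ler_pdivlMr//; exact: H.
have cle (G : R -> R) : (forall x, G x = G (c x)) -> nondecreasing G ->
    (forall x, G a <= G x) /\ (forall x, G x <= G b).
  by move=> Gc ndG; split => x; rewrite (Gc x); apply: ndG.
have cc x : c (c x) = c x by rewrite cid// ca cb.
have [|Pa Pb] := cle P _ ndP; first by move=> x; rewrite /P cc.
have [|Na Nb] := cle N _ ndN; first by move=> x; rewrite /N /P cc.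
have [hP ihP hPE] := nondecreasing_abs_increasing_density ndP acP Pa Pb.
have [hN ihN hNE] := nondecreasing_abs_increasing_density ndN acN Na Nb.
exists (hP \- hN); first by apply: (integrableB measurableT ihP ihN).
move=> x /andP[ax xb].
have -> : f x - f a = (P x - P a) - (N x - N a).
  by rewrite /N (cid x) ?ax// (cid a) ?lexx ?(ltW ab)//; ring.
rewrite EFinB hPE// hNE//.
have iS h : lambda.-integrable setT (EFin \o h) ->
    lambda.-integrable `]a, x]%classic (EFin \o h).
  exact: integrableS.
by rewrite -integralB//; [exact: iS..].
Qed.

(* [lebesgue_measure] lives on the Borel sets and is not complete: [derive1 f],
   which is only known almost everywhere, may fail to be measurable, hence [h]. *)
Theorem abs_continuous_on_FTC a b f : a < b -> abs_continuous_on a b f ->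
  exists h : R -> R, [/\ lambda.-integrable setT (EFin \o h),
    {ae lambda, forall x, x \in `]a, b[ -> is_derive x 1 f (h x)} &
    (\int[lambda]_(x in `[a, b]) (h x)%:E)%E = (f b - f a)%:E].
Proof.
move=> ab /(abs_continuous_on_density ab)[h ih hE].
have itvE x : (\int[lambda]_(z in `[a, x]) (h z)%:E)%E =
    (\int[lambda]_(z in `]a, x]) (h z)%:E)%E.
  rewrite -integral_itv_obnd_cbnd//; apply: measurable_funTS.
  exact: (measurable_int _ ih).
exists h; split => //; last first.
  by rewrite itvE hE// lexx ltW.
have iS A : measurable A -> lambda.-integrable A (EFin \o h).
  by move=> mA; exact: integrableS ih.
have loc : locally_integrable setT h.
  by apply: open_integrable_locally => //; exact: openT.
(* Lebesgue differentiation yields the derivative of the indefinite integral almost everywhere; near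
   an interior point f differs from that integral by [f a]. *)
have := FTC1 (a := BLeft a) (fun y => iS _ (measurable_itv _)) loc.
apply: filterS; first exact: (ae_filter_ringOfSetsType lambda).
move=> x /=; rewrite lte_fin in_itv/= => H /andP[ax xb].
have [dF Fx] := H ax.
pose F y := f a + (\int[lambda]_(t in `[a, y]) h t)%R.
apply: (@near_eq_is_derive _ _ _ F).
- near=> y.
  have axb : a <= y <= b.
    apply/andP; split; apply: ltW; near: y; [exact: lt_nbhsr|exact: lt_nbhsl].
  by rewrite /F /Rintegral itvE -hE//= addrC subrK.
- have dG : is_derive x 1 (fun y => \int[lambda]_(t in `[a, y]) h t)%R (h x).
    by have := derivableP dF; rewrite -derive1E Fx.
  by rewrite -[h x]add0r; apply: is_deriveD.
Unshelve. all: by end_near. Qed.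
End fundamental_theorem.

Section abs_continuous_operations.
Context {R : realType}.
Implicit Types (a b : R) (f g : R -> R).

Lemma continuous_itv_bounded a b g : a <= b -> continuous g ->
  exists2 M : R, 0 <= M & forall x, a <= x <= b -> `|g x| <= M.
Proof.
move=> ab cg.
have cn : {within `[a, b], continuous (fun x => `|g x|)}.
  apply: continuous_subspaceT => x; apply: continuous_comp; first exact: cg.
  exact: norm_continuous.
have [c _ cM] := EVT_max ab cn.
by exists `|g c| => // x axb; apply: cM; rewrite in_itv.
Qed.

Lemma abs_continuous_on_C1 a b f df : (forall x : R, is_derive x 1 f (df x)) ->
  continuous df -> abs_continuous_on a b f.
Proof.
move=> fdf cdf.
have [ba|ab] := ltP b a.
  move=> e e0; exists 1 => // n s t st _ _; rewrite big1// => i _.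
  by have [as_ ss tb] := st i; have := lt_le_trans ba (le_trans (le_trans as_ ss) tb); rewrite ltxx.
have [M M0 HM] := continuous_itv_bounded ab cdf.
(* [M] may be 0, hence the division by [M + 1]. *)
have M1 : 0 < M + 1 by rewrite ltr_wpDl.
move=> e e0; exists (e / (M + 1)); first by rewrite divr_gt0.
move=> n s t st _ std.
apply: (@le_lt_trans _ _ ((M + 1) * \sum_(i < n) (t i - s i))); last first.
  by rewrite mulrC -ltr_pdivlMr.
rewrite mulr_sumr; apply: ler_sum => i _; have [as_ ss tb] := st i.
have cf : {within `[s i, t i], continuous f}.
  by apply: continuous_subspaceT; exact: is_derive_continuous fdf.
have [c] := @MVT_segment _ f df _ _ ss (fun x _ => fdf x) cf.
rewrite in_itv/= => /andP[sc ct] ->; rewrite normrM.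
rewrite [`|t i - s i|]ger0_norm ?subr_ge0// ler_wpM2r ?subr_ge0//.
apply: (@le_trans _ _ M); last by rewrite lerDl.
by apply: HM; rewrite (le_trans as_ sc) (le_trans ct tb).
Qed.

Lemma abs_continuous_on_bounded a b f : a <= b -> abs_continuous_on a b f ->
  exists2 M : R, 0 < M & forall x, a <= x <= b -> `|f x| <= M.
Proof.
move=> ab acf; have fin := abs_continuous_on_bounded_variation ab acf.
have V0 : 0 <= fine (total_variation a b f) by rewrite fine_ge0 ?total_variation_ge0.
exists (fine (total_variation a b f) + `|f a| + 1).
  by rewrite ltr_wpDl// addr_ge0.
move=> x /andP[ax xb]; rewrite (@le_trans _ _ (`|f x - f a| + `|f a|))//.
  by rewrite -[X in `|X| <= _](subrK (f a)) ler_normD.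
rewrite -addrA; apply: lerD; last by rewrite lerDl.
rewrite -lee_fin fineK//; apply: (le_trans (total_variation_ge f ax)).
by rewrite [leRHS](total_variationD f ax xb) leeDl// total_variation_ge0.
Qed.

Lemma abs_continuous_onM a b f g : abs_continuous_on a b f ->
  abs_continuous_on a b g -> abs_continuous_on a b (fun x => f x * g x).
Proof.
move=> acf acg.
have [ba|ab] := ltP b a.
  move=> e e0; exists 1 => // n s t st _ _; rewrite big1// => i _.
  by have [as_ ss tb] := st i; have := lt_le_trans ba (le_trans (le_trans as_ ss) tb); rewrite ltxx.
have [M M0 fM] := abs_continuous_on_bounded ab acf.
have [N N0 gN] := abs_continuous_on_bounded ab acg.
move=> e e0.
have eN : 0 < e / 2 / N by rewrite !divr_gt0.
have eM : 0 < e / 2 / M by rewrite !divr_gt0.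
have [d1 d10 H1] := acf _ eN.
have [d2 d20 H2] := acg _ eM.
exists (Num.min d1 d2); first by rewrite lt_min d10.
move=> n s t st dis; rewrite lt_min => /andP[std1 std2].
have S1 := H1 n s t st dis std1; have S2 := H2 n s t st dis std2.
apply: (@le_lt_trans _ _ (N * \sum_(i < n) `|f (t i) - f (s i)| +
                          M * \sum_(i < n) `|g (t i) - g (s i)|)).
  rewrite !mulr_sumr -big_split/=; apply: ler_sum => i _.
  have [as_ ss tb] := st i.
  have -> : f (t i) * g (t i) - f (s i) * g (s i) =
    g (t i) * (f (t i) - f (s i)) + f (s i) * (g (t i) - g (s i)) by ring.
  rewrite (le_trans (ler_normD _ _))// !normrM lerD// ler_wpM2r//.
    by apply: gN; rewrite (le_trans as_ ss).
  by apply: fM; rewrite as_ (le_trans ss tb).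
rewrite (splitr e) ltrD//; first by rewrite mulrC -ltr_pdivlMr.
by rewrite mulrC -ltr_pdivlMr.
Qed.

End abs_continuous_operations.

(** * The density of a measure with a logarithmic gradient *)

Section antiderivative.
Context {R : realType}.
Notation lambda := (@lebesgue_measure R).

Lemma continuous_integrable_itv (h : R -> R) (a b : R) (x y : bool) :
  continuous h ->
  lambda.-integrable [set` Interval (BSide x a) (BSide y b)] (EFin \o h).
Proof.
move=> ch; apply: (@integrableS _ _ _ lambda `[a, b]) => //.
  by move=> z; rewrite /= !in_itv/=; case: x; case: y => /= /andP[? ?]; apply/andP; split=> //; exact: ltW.
apply: continuous_compact_integrable; first exact: segment_compact.
exact: continuous_subspaceT.
Qed.

Lemma antiderivative_ex (h : R -> R) : continuous h ->
  exists F : R -> R, forall x : R, is_derive x 1 F (h x).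
Proof.
move=> ch; have ih a b x y := @continuous_integrable_itv h a b x y ch.
pose G (c y : R) := (\int[lambda]_(t in `[c, y]) h t)%R.
have dG (c x : R) : c < x -> is_derive x 1 (G c) (h x).
  move=> cx.
  have [||D E] := @continuous_FTC1 R h (BLeft c) x (x + 1) _ (ih _ _ _ _) _ (ch x).
  - by rewrite ltrDl.
  - by rewrite lte_fin.
  by have := derivableP D; rewrite -derive1E E.
have GB (c x y : R) : c <= x -> x <= y -> G c y - G c x = (\int[lambda]_(t in `]x, y]) h t)%R.
  by move=> cx xy; rewrite /G Rintegral_itvB// bnd_simp.
pose F (y : R) : R := if 0 <= y then (\int[lambda]_(t in `]0, y]) h t)%R
  else - (\int[lambda]_(t in `]y, 0]) h t)%R.
(* The integral is differentiated to the right of its base point, so the base is moved left of both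
   x and 0; near x this changes [F] by a constant. *)
exists F => x; pose c := - (`|x| + 1).
have cx : c < x by rewrite /c ltrNl; have := ler_norm (- x); rewrite normrN; lra.
have c0 : c < 0 by rewrite /c oppr_lt0 ltr_wpDl.
apply: (@near_eq_is_derive _ _ _ (fun y => G c y - G c 0)); last first.
  by rewrite -[h x]subr0; apply: is_derive_sub; exact: dG.
near=> y; rewrite /F; case: leP => y0; first by rewrite GB// ltW.
rewrite -(GB c) ?ltW//; last by near: y; exact: lt_nbhsr.
by rewrite opprB.
Unshelve. all: by end_near. Qed.

Lemma integral_is_derive (h F : R -> R) (a b : R) : (forall x : R, is_derive x 1 F (h x)) ->
  continuous h -> a <= b -> (\int[lambda]_(t in `[a, b]) (h t)%:E)%E = (F b - F a)%:E.
Proof.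
move=> Fh ch; rewrite le_eqVlt => /predU1P[<-|ab].
  by rewrite set_itv1 integral_set1 subrr.
rewrite EFinB; apply: (continuous_FTC2 ab).
- exact: continuous_subspaceT.
- have cF := is_derive_continuous Fh; split.
  + by move=> x _; exact: ex_derive.
  + by apply: cvg_at_right_filter; exact: cF.
  + by apply: cvg_at_left_filter; exact: cF.
- by move=> x _; rewrite (derive1_is_derive Fh).
Qed.

End antiderivative.

(** * Integration against a measure known on open intervals *)

Section density.
Context {R : realType}.
Notation lambda := (@lebesgue_measure R).
Variables (mu : probability (measurableTypeR R) R) (p F : R -> R).
Hypothesis p0 : forall x, 0 <= p x.
Hypothesis cp : continuous p.
Hypothesis Fp : forall x : R, is_derive x 1 F (p x).
Hypothesis muE : forall x y, x < y -> mu `]x, y[%classic = (F y - F x)%:E.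

Let mp : measurable_fun setT (EFin \o p).
Proof. by apply/measurable_EFinP; exact: continuous_measurable_fun. Qed.

Let ndF : nondecreasing F.
Proof.
move=> x y; rewrite le_eqVlt => /predU1P[->//|xy].
by rewrite -subr_ge0 -lee_fin -muE.
Qed.

(** No mass sits at y: the half-open interval lies in an open one ending slightly further right, and
    [F] is continuous. *)
Let muocE x y : x <= y -> mu `]x, y]%classic = (F y - F x)%:E.
Proof.
rewrite le_eqVlt => /predU1P[<-|xy].
  by rewrite set_itvoc0 measure0 subrr.
apply/eqP; rewrite eq_le; apply/andP; split; last first.
  rewrite -muE//; apply: le_measure; rewrite ?inE//; exact: subset_itv_oo_oc.
apply/lee_addgt0Pr => e e0.
have : {for y, continuous F} by exact: (is_derive_continuous Fp).
move=> /cvgrPdist_le/(_ e e0) Fe.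
have Fe' : \forall z \near y^'+, `|F y - F z| <= e.
  exact: cvg_within Fe.
near y^'+ => z.
have yz : y < z by near: z; exact: nbhs_right_gt.
apply: (@le_trans _ _ (mu `]x, z[%classic)).
  apply: le_measure; rewrite ?inE//.
  by apply: subset_itvl; rewrite bnd_simp.
rewrite muE ?(lt_trans xy)// -EFinD lee_fin -addrAC lerD2r -lerBlDl.
rewrite -[leLHS]opprB lerNl.
have : `|F y - F z| <= e by near: z.
by rewrite ler_norml => /andP[].
Unshelve. all: by end_near. Qed.

(** Both sides are measures that agree with the Stieltjes measure of [F] on half-open intervals,
    which determine it. *)
Lemma density_measureE A : measurable A ->
  mu A = (\int[lambda]_(x in A) (p x)%:E)%E.
Proof.
have rcF : right_continuous F.
  by move=> x; apply: cvg_at_right_filter; exact: (is_derive_continuous Fp).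
pose C : cumulative R R := HB.pack F (isCumulative.Build R _ R F ndF rcF).
pose nu (A : set (measurableTypeR R)) := (\int[lambda]_(x in A) (p x)%:E)%E.
have nu0 : nu set0 = 0%E by rewrite /nu integral_set0.
have nuge0 B : (0 <= nu B)%E by apply: integral_ge0 => x _; rewrite lee_fin.
have nusigma : semi_sigma_additive nu.
  by apply: semi_sigma_additive_nng_induced => // x; rewrite lee_fin.
pose nuM : {measure set (measurableTypeR R) -> \bar R} :=
  HB.pack nu (isMeasure.Build _ _ _ nu nu0 nuge0 nusigma).
have CE x y : x <= y -> lebesgue_stieltjes_measure C `]x, y]%classic = (F y - F x)%:E.
  move=> xy; rewrite /lebesgue_stieltjes_measure /measure_extension.
  by rewrite measurable_mu_extE/=; [rewrite wlength_itv_bnd|exact: is_ocitv].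
move=> mA; transitivity (lebesgue_stieltjes_measure C A).
  apply/esym/lebesgue_stieltjes_measure_unique => // X /ocitvP[->|[[x y]/= xy ->]].
    by rewrite !measure0.
  by rewrite CE ?muocE ?ltW.
transitivity (nuM A); last by [].
apply: lebesgue_stieltjes_measure_unique => // X /ocitvP[->|[[x y]/= xy ->]].
  by rewrite !measure0.
rewrite CE ?ltW//= /nu integral_itv_obnd_cbnd; last first.
  exact: measurable_funTS.
by rewrite (integral_is_derive Fp cp (ltW xy)).
Qed.

(** The change of variables holds for the Radon-Nikodym derivative, and this equals p almost
    everywhere because both have the same integrals over measurable sets. *)
Lemma ge0_integral_density (g : R -> \bar R) : measurable_fun setT g ->
  (forall x, (0 <= g x)%E) ->
  (\int[mu]_x g x = \int[lambda]_x (g x * (p x)%:E))%E.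
Proof.
move=> mg g0.
have dom : mu `<< lambda.
  apply/null_content_dominatesP => A mA A0; rewrite density_measureE//.
  by apply: null_set_integral => //; exact: measurable_funTS.
rewrite -(Radon_Nikodym_SigmaFinite.change_of_variables dom)//.
have mr : measurable_fun setT (Radon_Nikodym_SigmaFinite.f mu lambda).
  exact: (measurable_int _ (Radon_Nikodym_SigmaFinite.f_integrable dom)).
have r0 x : (0 <= Radon_Nikodym_SigmaFinite.f mu lambda x)%E.
  exact: Radon_Nikodym_SigmaFinite.f_ge0.
apply: ge0_ae_eq_integral => //.
- exact: emeasurable_funM.
- exact: emeasurable_funM.
- by move=> x _; rewrite mule_ge0.
- by move=> x _; rewrite mule_ge0// lee_fin.
apply: ae_eqe_mul2l; apply: integral_ae_eq => //.
  exact: Radon_Nikodym_SigmaFinite.f_integrable.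
move=> E _ mE; rewrite -density_measureE//.
by rewrite -Radon_Nikodym_SigmaFinite.f_integral.
Qed.

End density.

(** * From the logarithmic gradient to the density *)

Section weak_density.
Context {R : realType}.
Notation lambda := (@lebesgue_measure R).
Variable mu : probability (measurableTypeR R) R.

Lemma bounded_integrable (h : R -> R) (C : R) : measurable_fun setT h ->
  (forall x, `|h x| <= C) -> mu.-integrable setT (EFin \o h).
Proof.
move=> mh hC; apply: measurable_bounded_integrable => //.
  by apply: (le_lt_trans (probability_le1 mu measurableT)); exact: ltry.
exists C; split; first exact: num_real.
by move=> x Cx z _; exact: le_trans (hC z) (ltW Cx).
Qed.

Lemma continuous_support_bounded (h : R -> R) (M : R) : 0 < M -> continuous h ->
  (forall x, ~~ (- M < x < M) -> h x = 0) -> exists C, forall x, `|h x| <= C.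
Proof.
move=> M0 ch hM.
have cn : {within `[- M, M], continuous (fun x => `|h x|)}.
  apply: continuous_subspaceT => x; apply: continuous_comp; first exact: ch.
  exact: norm_continuous.
have MM : - M <= M by rewrite ge0_cp// ltW.
have [c _ cM] := EVT_max MM cn.
exists `|h c| => x; have [xM|/hM ->] := boolP (- M < x < M); last by rewrite normr0.
by apply: cM; rewrite in_itv/=; move/andP : xM => [? ?]; rewrite !ltW.
Qed.

Lemma continuous_support_integrable (h : R -> R) (M : R) : 0 < M ->
  continuous h -> (forall x, ~~ (- M < x < M) -> h x = 0) ->
  mu.-integrable setT (EFin \o h).
Proof.
move=> M0 ch hM; have [C hC] := continuous_support_bounded M0 ch hM.
by apply: bounded_integrable hC; exact: continuous_measurable_fun.
Qed.

Lemma is_derive_eq0_const (F h : R -> R) (x y : R) :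
  (forall z : R, is_derive z 1 F (h z)) -> x <= y ->
  (forall z, x <= z <= y -> h z = 0) -> F y = F x.
Proof.
move=> Fh xy h0.
have cF : {within `[x, y], continuous F}.
  by apply: continuous_subspaceT; exact: is_derive_continuous Fh.
have [c] := @MVT_segment _ F h _ _ xy (fun z _ => Fh z) cF.
by rewrite in_itv/= => /h0 -> /eqP; rewrite mul0r subr_eq0 => /eqP.
Qed.

Variables (vmu Q : R -> R).
Hypothesis hvmu : is_log_gradient mu vmu.
Hypothesis sQ : smooth Q.
Hypothesis Qv : forall x : R, is_derive x 1 Q (vmu x).

Let w (x : R) := expR (- Q x).

Let smooth_w : smooth w.
Proof.
apply/smoothP => n; apply: smoothn_expR.
have -> : (fun x => - Q x) = cst (-1) \* Q by apply/funext => x /=; rewrite mulN1r.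
by apply: smoothnM; [exact: smoothn_cst|move/smoothP : sQ].
Qed.

Let cvmu : continuous vmu.
Proof. by rewrite -(derive1_is_derive Qv); apply: smooth_continuous; exact: smooth_derive1. Qed.

Let cw : continuous w. Proof. exact: smooth_continuous. Qed.

Let continuousM (f g : R -> R) : continuous f -> continuous g -> continuous (fun x => f x * g x).
Proof. by move=> cf cg x; apply: cvgM; [exact: cf|exact: cg]. Qed.

(** The margin 1 makes f vanish on a whole neighbourhood of x. *)
Lemma derive_support (f df : R -> R) (M : R) : (forall x : R, is_derive x 1 f (df x)) ->
  (forall x, ~~ (- M < x < M) -> f x = 0) -> forall x, ~~ (- (M + 1) < x < M + 1) -> df x = 0.
Proof.
move=> fdf fM x xM.
have /derive1_is_derive <- := fdf.
suff Dx : is_derive x 1 f 0 by rewrite derive1E derive_val.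
apply: (@near_eq_is_derive _ _ _ (cst 0)); near=> y; rewrite fM//; apply: contra xM.
move=> /andP[? ?].
have : `|x - y| <= 1.
  by near: y; apply: cvgr_dist_le => //; exact: cvg_id.
by rewrite ler_norml => /andP[? ?]; apply/andP; split; lra.
Unshelve. all: by end_near. Qed.

(** [w] is an integrating factor: (psi w)' = psi' w - vmu psi w, so testing the gradient identity on
    psi w cancels the terms in vmu. *)
Lemma log_gradient_weak (psi : R -> R) : test_function psi ->
  (\int[mu]_x (derive1 psi x * w x)%:E = 0)%E.
Proof.
move=> tpsi; have [_ hE] := hvmu.
have := hE _ (testM tpsi smooth_w); rewrite unlock.
have /test_functionP[spsi [M M0 psiM]] := tpsi.
have D (x : R) : is_derive x 1 (psi \* w) (derive1 psi x * w x - vmu x * psi x * w x).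
  have Dp := smooth_is_derive x spsi.
  have Dw := is_derive_exp (is_derive_opp (Qv x)).
  by apply: (is_derive_eq (is_derive_mul Dp Dw)); rewrite -/(w x); ring.
rewrite (derive1_is_derive D).
have i1 : mu.-integrable setT (EFin \o (fun x => derive1 psi x * w x)).
  apply: (@continuous_support_integrable _ (M + 1)); first by rewrite addr_gt0.
    by apply: continuousM => //; apply: smooth_continuous; exact: smooth_derive1.
  move=> x xM; rewrite (derive_support _ psiM xM) ?mul0r// => z.
  exact: smooth_is_derive.
have i2 : mu.-integrable setT (EFin \o (fun x => vmu x * psi x * w x)).
  apply: (@continuous_support_integrable _ M) => //.
    by do ![apply: continuousM => //]; exact: smooth_continuous.
  by move=> x xM; rewrite psiM ?mulr0 ?mul0r.
under eq_integral do rewrite EFinB.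
rewrite integralB_EFin//.
under [in RHS]eq_integral do rewrite /= mulrA.
have fin : (\int[mu]_x (vmu x * psi x * w x)%:E)%E \is a fin_num.
  exact: integrable_fin_num.
by move=> /(congr1 (fun z => z + \int[mu]_x (vmu x * psi x * w x)%:E)%E); rewrite subeK// addeC subee.
Qed.
(* A test function of integral zero has an antiderivative which is again a test
   function, so [w mu] is a multiple of Lebesgue measure. *)
Lemma log_gradient_proportional : exists2 c : R, 0 <= c &
  forall (h Phi : R -> R) (M : R), 1 <= M -> smooth h ->
    (forall x, ~~ (- M < x < M) -> h x = 0) ->
    (forall x : R, is_derive x 1 Phi (h x)) ->
    (\int[mu]_x (h x * w x)%:E = (c * (Phi M - Phi (- M)))%:E)%E.
Proof.
pose h0 : R -> R := bump 0 1 0.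
have sh0 : smooth h0 by exact: smooth_bump.
have ch0 : continuous h0 by exact: smooth_continuous.
have [Phi0 dPhi0] := antiderivative_ex ch0.
have h0M (M : R) x : 1 <= M -> ~~ (- M < x < M) -> h0 x = 0.
  move=> M1 xM; apply: bump_eq0; apply: contra xM => /andP[? ?].
  by apply/andP; split; lra.
have Phi0M M : 1 <= M -> Phi0 M - Phi0 (- M) = Phi0 1 - Phi0 0.
  move=> M1.
  have -> : Phi0 M = Phi0 1.
    apply: is_derive_eq0_const dPhi0 M1 _ => z /andP[z1 _]; apply: bump_eq0.
    by rewrite negb_and -!leNgt z1 orbT.
  have M0 : - M <= 0 by rewrite oppr_le0 (le_trans _ M1).
  rewrite -(is_derive_eq0_const dPhi0 M0)// => z /andP[_ z1]; apply: bump_eq0.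
  by rewrite negb_and -!leNgt z1.
have Phi0gt : 0 < Phi0 1 - Phi0 0.
  have cP : {within `[0, 1], continuous Phi0}.
    by apply: continuous_subspaceT; exact: is_derive_continuous dPhi0.
  have [c + ->] := MVT ltr01 (fun x _ => dPhi0 x) cP.
  by rewrite in_itv/= subr0 mulr1; exact: bump_gt0.
pose I0 := (\int[mu]_x (h0 x * w x))%R.
have ih0 : mu.-integrable setT (EFin \o (fun x => h0 x * w x)).
  apply: (@continuous_support_integrable _ 1) => //; first exact: continuousM.
  by move=> x /h0M ->//; rewrite mul0r.
have I0E : (\int[mu]_x (h0 x * w x)%:E)%E = I0%:E.
  by rewrite /I0 /Rintegral fineK//; exact: integrable_fin_num ih0.
(* The value at the reference bump [h0] fixes the constant of proportionality. *)
exists (I0 / (Phi0 1 - Phi0 0)).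
  rewrite divr_ge0// ?(ltW Phi0gt)//; apply: Rintegral_ge0 => x _.
  by rewrite mulr_ge0 ?bump_ge0 ?expR_ge0.
move=> h Phi M M1 sh hM dPhi; have M0 : 0 < M by exact: lt_le_trans M1.
have ch := smooth_continuous sh.
(* With this r the function h - r h0 has integral zero, so its primitive [psi] vanishes at both ends
   of the window. *)
pose r := (Phi M - Phi (- M)) / (Phi0 1 - Phi0 0).
pose psi x := Phi x - r * Phi0 x - (Phi (- M) - r * Phi0 (- M)).
have dpsi (x : R) : is_derive x 1 psi (h x - r * h0 x).
  have D := is_derive_sub (is_derive_sub (dPhi x) (is_derive_mul (is_derive_cst r x 1) (dPhi0 x)))
     (is_derive_cst (Phi (- M) - r * Phi0 (- M)) x 1).
  by apply: (is_derive_eq D); rewrite /cst; ring.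
have tpsi : test_function psi.
  apply/test_functionP; split.
    apply: (smooth_antiderivative dpsi); apply/smoothP => n.
    have -> : (fun x => h x - r * h0 x) = h \+ (cst (- r) \* h0).
      by apply/funext => x /=; rewrite mulNr.
    apply: smoothnD; first by move/smoothP : sh.
    by apply: smoothnM; [exact: smoothn_cst|move/smoothP : sh0].
  exists M => // x xM.
  have zM z : ~~ (- M < z < M) -> h z - r * h0 z = 0.
    by move=> zM; rewrite hM// (h0M _ _ M1 zM) mulr0 subrr.
  move: xM; rewrite negb_and -!leNgt => /orP[xM|Mx].
    rewrite -(is_derive_eq0_const dpsi xM); first by rewrite /psi subrr.
    by move=> z /andP[_ zM']; apply: zM; rewrite negb_and -!leNgt zM'.
  rewrite (is_derive_eq0_const dpsi Mx); last first.
    by move=> z /andP[zM' _]; apply: zM; rewrite negb_and -!leNgt zM' orbT.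
  rewrite /psi (_ : _ - _ = (Phi M - Phi (- M)) - r * (Phi0 M - Phi0 (- M))); last by ring.
  by rewrite Phi0M// divfK ?subrr// gt_eqF.
have := log_gradient_weak tpsi; rewrite (derive1_is_derive dpsi).
have ih : mu.-integrable setT (EFin \o (fun x => h x * w x)).
  apply: (@continuous_support_integrable _ M) => //; first exact: continuousM.
  by move=> x /hM ->//; rewrite mul0r.
under eq_integral do rewrite mulrBl -mulrA EFinB.
rewrite integralB_EFin//; last first.
  have := integrableZl measurableT r ih0; rewrite (_ : (fun x => _) = EFin \o (fun x => r * (h0 x * w x)))//.
under [X in (_ - X)%E]eq_integral do rewrite EFinM.
rewrite integralZl// I0E -EFinM.
move=> /(congr1 (fun z => z + (r * I0)%:E)%E); rewrite subeK// add0e => ->.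
by congr EFin; rewrite /r; ring.
Qed.

(** Testing on a bump times e^Q removes the weight [w]; dominated convergence under both measures
    then replaces the bump by the indicator of the interval. *)
Lemma log_gradient_density : exists c (F : R -> R), [/\ 0 < c,
  forall x : R, is_derive x 1 F (c * expR (Q x)) &
  forall x y, x < y -> mu `]x, y[%classic = (F y - F x)%:E].
Proof.
have [c c0 H] := log_gradient_proportional.
pose p x := c * expR (Q x).
have p0 x : 0 <= p x by rewrite mulr_ge0 ?expR_ge0.
have seQ : smooth (fun x => expR (Q x)).
  by apply/smoothP => n; apply: smoothn_expR; move/smoothP : sQ.
have cp : continuous p.
  by apply: continuousM; [exact: cst_continuous|exact: smooth_continuous].
have [F dF] := antiderivative_ex cp.
have muE x y : x < y -> mu `]x, y[%classic = (F y - F x)%:E.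
  move=> xy; pose M := 1 + `|x| + `|y|.
  have M1 : 1 <= M by rewrite /M -addrA lerDl addr_ge0.
  have bM n z : ~~ (- M < z < M) -> bump x y n z = 0.
    move=> zM; apply: bump_eq0; apply: contra zM => /andP[? ?].
    have := ler_norm (- x); have := ler_norm y; rewrite normrN => ? ?.
    have := normr_ge0 x; have := normr_ge0 y => ? ?.
    by apply/andP; split; rewrite /M; lra.
  have bE n : (\int[mu]_z (bump x y n z)%:E =
      \int[lambda]_(z in `[(- M)%R, M]) (bump x y n z * p z)%:E)%E.
    pose h := bump x y n \* (fun x => expR (Q x)).
    have sh : smooth h.
      apply/smoothP => k; apply: smoothnM; last by move/smoothP : seQ.
      by have /smoothP := @smooth_bump R x y n.
    have [Phi dPhi] := antiderivative_ex (smooth_continuous sh).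
    have hM z : ~~ (- M < z < M) -> h z = 0 by move=> zM; rewrite /h/= bM// mul0r.
    have := H h Phi M M1 sh hM dPhi.
    under eq_integral do rewrite /h/= -mulrA -expRD subrr expR0 mulr1.
    move=> ->; rewrite EFinM -(integral_is_derive dPhi (smooth_continuous sh)); last first.
      by rewrite ge0_cp// (le_trans _ M1).
    rewrite -integralZl//; last first.
      exact: continuous_integrable_itv (smooth_continuous sh).
    by apply: eq_integral => z _; rewrite -EFinM /h/= /p mulrCA.
  have bcvg z : bump x y n z @[n --> \oo] --> (\1_`]x, y[%classic z : R).
    rewrite indicE; have [xzy|xzy] := boolP (x < z < y).
      by rewrite mem_set/= ?in_itv//; exact: cvg_bump.
    rewrite memNset/= ?in_itv/=; last exact/negP.
    rewrite (_ : (fun n => _) = cst 0); first exact: cvg_cst.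
    by apply/funext => n; rewrite bump_eq0.
  have mb n : measurable_fun setT (bump x y n).
    by apply: continuous_measurable_fun; apply: smooth_continuous; exact: smooth_bump.
  have mI : measurable_fun setT (\1_`]x, y[%classic : R -> R).
    exact: measurable_indic.
  have mp : measurable_fun setT p by exact: continuous_measurable_fun.
  have [|||||_ _ c1] := @dominated_convergence _ _ _ mu setT measurableT
    (fun n z => (bump x y n z)%:E) (fun z => (\1_`]x, y[%classic z)%:E) (cst 1%E).
  - by move=> n; apply/measurable_EFinP; exact: mb.
  - by apply/measurable_EFinP; exact: mI.
  - by apply: aeW => z _; apply: cvg_EFin; [exact: nearW|exact: bcvg].
  - exact: finite_measure_integrable_cst.
  - by apply: aeW => z n _; rewrite lee_fin ger0_norm ?bump_ge0// bump_le1.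
  have [|||||_ _ c2] := @dominated_convergence _ _ _ lambda `[- M, M]%classic (measurable_itv _)
    (fun n z => (bump x y n z * p z)%:E) (fun z => (\1_`]x, y[%classic z * p z)%:E) (EFin \o p).
  - by move=> n; apply/measurable_EFinP/measurable_funTS; apply: measurable_funM; [exact: mb|exact: mp].
  - by apply/measurable_EFinP/measurable_funTS; apply: measurable_funM; [exact: mI|exact: mp].
  - apply: aeW => z _; apply: cvg_EFin; first exact: nearW.
    by apply: cvgM; [exact: bcvg|exact: cvg_cst].
  - exact: continuous_integrable_itv.
  - apply: aeW => z n _; rewrite lee_fin ger0_norm ?(mulr_ge0 (bump_ge0 _ _ _ _) (p0 _))//.
    by rewrite ler_piMl// bump_le1.
  have c1' : (\int[mu]_z (bump x y n z)%:E)%E @[n --> \oo] --> mu `]x, y[%classic.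
    by move: c1; rewrite integral_indic// setIT.
  have c2' : (\int[mu]_z (bump x y n z)%:E)%E @[n --> \oo] --> (F y - F x)%:E.
    have -> : (F y - F x)%:E = (\int[lambda]_(z in `[(- M)%R, M]) (\1_`]x, y[%classic z * p z)%:E)%E.
      rewrite -(integral_is_derive dF cp (ltW xy)).
      rewrite -integral_itv_obnd_cbnd; last first.
        by apply/measurable_EFinP/measurable_funTS; exact: mp.
      rewrite -integral_itv_bndo_bndc; last first.
        by apply/measurable_EFinP/measurable_funTS; exact: mp.
      have DM : `]x, y[%classic `<=` `[- M, M]%classic.
        move=> u; rewrite /= !in_itv/= => /andP[? ?].
        have := ler_norm (- x); have := ler_norm y; rewrite normrN => ? ?.
        have := normr_ge0 x; have := normr_ge0 y => ? ?.
        by apply/andP; split; rewrite /M; lra.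
      transitivity (\int[lambda]_(z in `[(- M)%R, M] `&` `]x, y[) (p z)%:E)%E.
        by rewrite (setIidr DM).
      rewrite integral_mkcondr; apply: eq_integral => u _.
      by rewrite patchE indicE; case: (u \in _); rewrite ?mul1r ?mul0r.
    rewrite (_ : (fun n => _) = [sequence \int[lambda]_(u in `[(- M)%R, M]) (bump x y n u * p u)%:E]_n)%E.
      exact: c2.
    by apply/funext => n; exact: bE.
  by have := cvg_unique _ c1' c2'; apply.
(* If c were 0, mu would be the zero measure. *)
exists c, F; split => //; rewrite lt_neqAle c0 andbT; apply/eqP => c0'.
have := @density_measureE _ mu p F p0 cp dF muE setT measurableT.
rewrite probability_setT; rewrite /p -c0'.
under eq_integral do rewrite mul0r.
by rewrite integral0 => /eqP; rewrite onee_eq0.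
Qed.
End weak_density.

(** * Pointwise form of the divergence *)

Section divergence.
Context {R : realType}.
Notation lambda := (@lebesgue_measure R).
Variable mu : probability (measurableTypeR R) R.
Hypothesis mu_itv_gt0 : forall x y : R, x < y -> (0 < mu `]x, y[%classic)%E.

(** If u were positive at x, it would be so on a ball; the bump on that ball times u would be
    nonnegative with integral zero, hence zero almost everywhere, against [mu_itv_gt0]. *)
Lemma integral_bump_le0 (u : R -> R) : continuous u ->
  (forall x y, (\int[mu]_z (bump x y 0 z * u z)%:E = 0)%E) -> forall x, u x <= 0.
Proof.
move=> cu H x; rewrite leNgt; apply/negP => ux.
have : \forall z \near x, 0 < u z.
  have /cvgrPdist_lt/(_ _ ux) := cu x.
  by apply: filterS => z; rewrite ltr_norml => /andP[]; lra.
move=> /nbhs_ballP[d /= d0 ud].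
have bu z : 0 <= bump (x - d) (x + d) 0 z * u z.
  have [zd|zd] := boolP (x - d < z < x + d); last by rewrite bump_eq0// mul0r.
  rewrite mulr_ge0 ?bump_ge0// ltW//; apply: ud.
  by rewrite /ball/= ltr_distlC.
have mbu : measurable_fun setT (EFin \o (fun z => bump (x - d) (x + d) 0 z * u z)).
  apply/measurable_EFinP; apply: measurable_funM; apply: continuous_measurable_fun => //.
  by apply: smooth_continuous; exact: smooth_bump.
have := (ae_eq_integral_abs mu measurableT mbu).1.
rewrite (_ : (\int[mu]_z _)%E = 0%E); last first.
  rewrite -(H (x - d) (x + d)); apply: eq_integral => z _.
  by rewrite /= ger0_norm.
move=> /(_ erefl)[N [mN N0 sN]].
have dd : x - d < x + d by rewrite ltrD2l gtrN.
have := mu_itv_gt0 dd; rewrite ltNge => /negP; apply.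
rewrite -N0; apply: le_measure; rewrite ?inE//.
move=> z /= zd; apply: sN => /= /(_ Logic.I)/eqP; apply/negP.
rewrite eqe mulf_neq0// gt_eqF//; first exact: bump_gt0.
by apply: ud; rewrite /ball/= ltr_distlC; move: zd; rewrite in_itv.
Qed.

(** Testing the gradient on b K and the divergence on b, for every bump b, shows that the continuous
    function v + K' + K vmu integrates to zero against b; the sign lemma applies to it and to its
    opposite. *)
Lemma divergenceE (vmu v K : R -> R) : is_log_gradient mu vmu ->
  is_divergence mu K v -> continuous vmu -> continuous v -> smooth K ->
  forall x, v x = - K x * vmu x - derive1 K x.
Proof.
move=> [_ hvmu] [_ hv] cvmu cv sK.
have cK := smooth_continuous sK.
have cK' : continuous (derive1 K) by apply: smooth_continuous; exact: smooth_derive1.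
pose u x := v x + derive1 K x + K x * vmu x.
have cu : continuous u.
  by move=> x; apply: cvgD; [apply: cvgD; [exact: cv|exact: cK']|apply: cvgM; [exact: cK|exact: cvmu]].
have int (g : R -> R) x y : continuous g ->
    mu.-integrable setT (EFin \o (fun z => bump x y 0 z * g z)).
  move=> cg; pose M := 1 + `|x| + `|y|.
  have M0 : 0 < M by rewrite /M -addrA ltr_pwDl// addr_ge0.
  apply: (continuous_support_integrable mu M0).
    move=> z; apply: cvgM; last exact: cg.
    by apply: smooth_continuous; exact: smooth_bump.
  move=> z zM; rewrite bump_eq0 ?mul0r//; apply: contra zM => /andP[? ?].
  have := ler_norm (- x); have := ler_norm y; rewrite normrN => ? ?.
  have := normr_ge0 x; have := normr_ge0 y => ? ?.
  by apply/andP; split; rewrite /M; lra.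
have H x y : (\int[mu]_z (bump x y 0 z * u z)%:E = 0)%E.
  have tb := @test_bump R x y 0; pose b := bump x y 0.
  have sb : smooth b by exact: smooth_bump.
  have := hvmu _ (testM tb sK); have [ib] := hv _ tb; rewrite unlock.
  have D (z : R) : is_derive z 1 (b \* K) (derive1 b z * K z + b z * derive1 K z).
    by apply: is_derive_mul; exact: smooth_is_derive.
  rewrite (derive1_is_derive D) => E1 E2.
  have : (\int[mu]_z (derive1 b z * K z)%:E + \int[mu]_z (b z * derive1 K z)%:E =
     - \int[mu]_z (b z * (K z * vmu z))%:E)%E.
    rewrite -integralD_EFin//; last exact: int.
    rewrite E2; congr (- _)%E; apply: eq_integral => z _.
    by congr EFin; rewrite /= -/b; ring.
  rewrite E1 => E3.
  have cKv : continuous (fun z => K z * vmu z).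
    by move=> z; apply: cvgM; [exact: cK|exact: cvmu].
  transitivity (\int[mu]_z (b z * v z)%:E + \int[mu]_z (b z * derive1 K z)%:E +
     \int[mu]_z (b z * (K z * vmu z))%:E)%E; last first.
    rewrite E3 addeC subee//; apply: integrable_fin_num => //; exact: int cKv.
  rewrite -integralD_EFin//; [|exact: int..].
  rewrite -integralD_EFin//; [|rewrite (_ : EFin \o _ = EFin \o (fun z => b z * (v z + derive1 K z)))|exact: int cKv].
  - by apply: eq_integral => z _; rewrite /= -!EFinD; congr EFin; rewrite /u -/b; ring.
  - by apply: int => z; apply: cvgD; [exact: cv|exact: cK'].
  - by apply/funext => z; rewrite /=; congr EFin; ring.
have H' x y : (\int[mu]_z (bump x y 0 z * - u z)%:E = 0)%E.
  under eq_integral do rewrite mulrN -mulN1r EFinM.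
  by rewrite integralZl//; [rewrite H mule0|exact: (int _ x y cu)].
move=> x; have := integral_bump_le0 cu H x.
have cNu : continuous (fun x => - u x) by move=> z; apply: cvgN; exact: cu.
have := integral_bump_le0 cNu H' x.
by rewrite oppr_le0 => u0 u1; have : u x = 0; [by apply/le_anti/andP|rewrite /u; lra].
Qed.
End divergence.

(** * Monotone transport *)

Section transport.
Context {R : realType}.
Notation lambda := (@lebesgue_measure R).
Implicit Types x y z : R.

Lemma is_derive_ge0_le (G h : R -> R) x y : (forall z, is_derive z 1 G (h z)) ->
  x <= y -> (forall z, x <= z <= y -> 0 <= h z) -> G x <= G y.
Proof.
move=> Gh xy h0.
have cG : {within `[x, y], continuous G}.
  by apply: continuous_subspaceT; exact: is_derive_continuous Gh.
have [c] := @MVT_segment _ G h _ _ xy (fun z _ => Gh z) cG.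
by rewrite in_itv/= => /h0 hc Gc; rewrite -subr_ge0 Gc mulr_ge0// subr_ge0.
Qed.

Lemma is_derive_gt0_lt (G h : R -> R) x y : (forall z, is_derive z 1 G (h z)) ->
  (forall z, 0 < h z) -> x < y -> G x < G y.
Proof.
move=> Gh h0 xy.
have cG : {within `[x, y], continuous G}.
  by apply: continuous_subspaceT; exact: is_derive_continuous Gh.
have [c _ Gc] := MVT xy (fun z _ => Gh z) cG.
by rewrite -subr_gt0 Gc mulr_gt0 ?subr_gt0.
Qed.

Lemma ln_le_subr1 x : 0 < x -> ln x <= x - 1.
Proof. by move=> x0; rewrite -ler_expR lnK// (le_trans _ (expR_ge1Dx _))//; lra. Qed.

Section convexity.
Variables (k v dv K phi p : R -> R) (alpha : R).
Hypothesis K0 : forall x, 0 < K x.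
Hypothesis p0 : forall x, 0 < p x.
Hypothesis kE : forall x, k x = K x * p x.
Hypothesis dk : forall x, is_derive x 1 k (- (v x * p x)).
Hypothesis dphi : forall x, is_derive x 1 phi (K x)^-1.
Hypothesis dvE : forall x, is_derive x 1 v (dv x).
Hypothesis alphaE : forall x, alpha <= K x * dv x.

(* [- ln k] is [alpha]-convex in the coordinate [phi]. *)
Lemma log_density_convex x y :
  v x * (phi y - phi x) + alpha / 2 * (phi y - phi x) ^+ 2 <= ln (k x) - ln (k y).
Proof.
have k0 z : 0 < k z by rewrite kE mulr_gt0.
(* In the variable phi, v is the derivative of V = - ln k, so V'' >= alpha says that [E] is
   nondecreasing. *)
pose E z := v z - alpha * phi z.
have ndE : {homo E : z z' / z <= z'}.
  move=> z z' zz'.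
  have dE (u : R) : is_derive u 1 E (dv u - alpha * (K u)^-1).
    exact: is_derive_sub.
  apply: is_derive_ge0_le dE zz' _.
  by move=> u _; rewrite subr_ge0 ler_pdivrMr// mulrC.
pose D z := ln (k x) - ln (k z) - (v x * (phi z - phi x) + alpha / 2 * (phi z - phi x) ^+ 2).
(* The gap [D] vanishes at x and its derivative has the sign of [E z - E x], so x is its minimum. *)
have dD (z : R) : is_derive z 1 D ((E z - E x) / K z).
  have D1 := is_derive_log (k0 z) (dk z).
  have D2 := is_derive_sub (dphi z) (is_derive_cst (phi x) z 1).
  have D3 := is_derive_sqr D2.
  have D4 := is_derive_mul (is_derive_cst (v x) z 1) D2.
  have D5 := is_derive_mul (is_derive_cst (alpha / 2) z 1) D3.
  have D6 := is_derive_sub (is_derive_cst (ln (k x)) z 1) D1.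
  apply: (is_derive_eq (is_derive_sub D6 (is_derive_add D4 D5))).
  rewrite /cst /E kE; field.
  by rewrite !gt_eqF.
have Dx : D x = 0 by rewrite /D !subrr expr0n/= !mulr0 addr0 subrr.
suff : 0 <= D y by rewrite /D subr_ge0.
have [xy|/ltW yx] := leP x y.
  rewrite -Dx; apply: is_derive_ge0_le dD xy _ => z /andP[xz _].
  by rewrite divr_ge0 ?(ltW (K0 z))// subr_ge0 ndE.
have dND (z : R) : is_derive z 1 (fun z => - D z) ((E x - E z) / K z).
  by apply: (is_derive_eq (is_derive_opp (dD z))); rewrite -mulNr opprB.
have := is_derive_ge0_le dND yx; rewrite Dx lerN2; apply => z /andP[_ zx].
by rewrite divr_ge0 ?(ltW (K0 z))// subr_ge0 ndE.
Qed.

End convexity.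

Section monotone_rearrangement.
Variables (p F : R -> R).
Hypothesis p0 : forall x, 0 < p x.
Hypothesis dF : forall x, is_derive x 1 F (p x).

(** [T] is the inverse of [F] applied to [Y]; the bounds on [Y] keep it within the values of [F] on
    [a, b]. *)
Lemma monotone_rearrangement (Y dY : R -> R) a b : a <= b ->
  (forall x, F a <= Y x <= F b) -> (forall x, is_derive x 1 Y (dY x)) ->
  exists2 T : R -> R, forall x, F (T x) = Y x &
    forall x, is_derive x 1 T (dY x / p (T x)).
Proof.
move=> ab FY dYE.
have cF : continuous F := is_derive_continuous dF.
have Finj x y : F x = F y -> x = y.
  move=> Fxy; have [xy|xy|//] := ltgtP x y.
    by have := is_derive_gt0_lt dF p0 xy; rewrite Fxy ltxx.
  by have := is_derive_gt0_lt dF p0 xy; rewrite Fxy ltxx.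
(* [get] is arbitrary off the range of [F]; the inverse rule below uses [G] only through G (F t) =
   t. *)
pose G u := get [set t | F t = u].
have FK : cancel F G.
  by move=> t; apply: Finj; rewrite /G; exact: (@getPex _ [set s | F s = F t] (ex_intro _ t erefl)).
have GK x : F (G (Y x)) = Y x.
  have [|c _ Fc] := @IVT _ F a b (Y x) ab (continuous_subspaceT cF).
    by have := FY x; rewrite ge_min le_max => /andP[-> ->]; rewrite orbT.
  exact: (@getPex _ [set s | F s = Y x] (ex_intro _ c Fc)).
exists (fun x => G (Y x)) => // x.
have dG : is_derive (Y x) 1 G (p (G (Y x)))^-1.
  rewrite -[in X in is_derive X](GK x); apply: is_derive_inverse => //.
  - by exists 1 => //= t _; exact: FK.
  - by exists 1 => //= t _; exact: cF.
  - by rewrite gt_eqF.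
by rewrite mulrC; exact: is_derive_comp dG (dYE x).
Qed.

End monotone_rearrangement.
End transport.

(** * The transport inequality *)

Section transport_inequality.
Context {R : realType}.
Notation lambda := (@lebesgue_measure R).
Implicit Types x y z : R.
Variables (k v dv K phi p F : R -> R) (alpha : R).
Hypothesis alpha0 : 0 < alpha.
Hypothesis K0 : forall x, 0 < K x.
Hypothesis cK : continuous K.
Hypothesis p0 : forall x, 0 < p x.
Hypothesis cp : continuous p.
Hypothesis dF : forall x, is_derive x 1 F (p x).
Hypothesis kE : forall x, k x = K x * p x.
Hypothesis dk : forall x, is_derive x 1 k (- (v x * p x)).
Hypothesis dphi : forall x, is_derive x 1 phi (K x)^-1.
Hypothesis dvE : forall x, is_derive x 1 v (dv x).
Hypothesis alphaE : forall x, alpha <= K x * dv x.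

(** Here t, tau, f and d stand for the values at x of T, T', f and f'. The equation for tau is the
    Jacobian equation of the transport, and the right side is the derivative of k f^2 (phi o T -
    phi). *)
Lemma transport_pointwise x t f d Z m tau : 0 < Z -> 0 < m ->
  tau = Z * (f ^+ 2 * p x) / m / p t ->
  f ^+ 2 * p x * ln (f ^+ 2 / m) + f ^+ 2 * p x * ln Z - 2 / alpha * (p x * (K x * d) ^+ 2)
  <= - (v x * p x) * (f ^+ 2 * (phi t - phi x)) +
     k x * (2 * f * d * (phi t - phi x) + f ^+ 2 * (tau / K t - (K x)^-1)).
Proof.
(* At a zero of f the slope q used below would be 0, outside the domain of the logarithm; there only
   the nonpositive gradient term remains. *)
move=> Z0 m0 tauE; have [->|f0] := eqVneq f 0.
  rewrite expr0n/= !(mul0r, mulr0, add0r, addr0) oppr_le0.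
  by apply: mulr_ge0; [rewrite divr_ge0// ltW|rewrite mulr_ge0 ?sqr_ge0// ltW].
have f20 : 0 < f ^+ 2 by rewrite exprn_even_gt0.
set th := phi t - phi x.
have k0 z : 0 < k z by rewrite kE mulr_gt0.
have conv := log_density_convex K0 p0 kE dk dphi dvE alphaE x t.
have tau0 : 0 < tau by rewrite tauE divr_gt0// divr_gt0// mulr_gt0// mulr_gt0.
pose q := K x * tau / K t.
have q0 : 0 < q by rewrite divr_gt0// mulr_gt0.
have lnE : ln (f ^+ 2 / m) + ln Z = ln q + ln (k t) - ln (k x).
  have fm0 : 0 < f ^+ 2 / m by rewrite divr_gt0.
  have -> : ln (f ^+ 2 / m) + ln Z = ln (f ^+ 2 / m * Z) by rewrite [RHS]lnM ?posrE.
  have -> : ln q + ln (k t) - ln (k x) = ln (q * k t / k x).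
    have e1 : ln (q * k t) = ln q + ln (k t) by rewrite lnM ?posrE.
    by rewrite [RHS]ln_div; [rewrite e1|rewrite posrE mulr_gt0|rewrite posrE].
  congr ln; rewrite /q tauE !kE; field.
  by rewrite !gt_eqF.
have lnq := ln_le_subr1 q0.
have key : ln (f ^+ 2 / m) + ln Z <= q - 1 - v x * th - alpha / 2 * th ^+ 2.
  by rewrite lnE; move: conv; rewrite -/th; lra.
have gp : 0 < f ^+ 2 * p x by rewrite mulr_gt0.
have := ler_wpM2l (ltW gp) key.
(* This square absorbs the cross term in [f * d] and the quadratic term coming from convexity. *)
have sq : 0 <= p x * (alpha / 2 * (th * f + 2 / alpha * (K x * d)) ^+ 2).
  rewrite mulr_ge0 ?(ltW (p0 x))//; apply: mulr_ge0; last exact: sqr_ge0.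
  by rewrite divr_ge0// ltW.
rewrite mulrDr => key'.
(* The difference of the two sides is exactly the slack in [key'] plus the square. *)
rewrite -subr_ge0; rewrite -subr_ge0 in key'.
apply: le_trans (addr_ge0 key' sq) _.
rewrite le_eqVlt; apply/orP; left; apply/eqP; rewrite /q kE; field.
by rewrite !gt_eqF.
Qed.

(** Applying ln s <= s - 1 at t and at 1 / t gives t - 1 <= t ln t <= t^2 - t. This crude bound
    supplies integrability when f is bounded. *)
Lemma normr_xlnx_le (t : R) : 0 <= t -> `|t * ln t| <= 1 + t ^+ 2.
Proof.
rewrite le_eqVlt => /predU1P[<-|t0]; first by rewrite mul0r normr0 addr_ge0// sqr_ge0.
have h1 := ln_le_subr1 t0.
have ti0 : 0 < t^-1 by rewrite invr_gt0.
have h2 : t * ln t >= t - 1.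
  have := ln_le_subr1 ti0; rewrite lnV ?posrE// => h.
  have := ler_wpM2l (ltW t0) h; rewrite mulrN mulrBr divff ?gt_eqF// mulr1.
  by lra.
have h3 : t * ln t <= t * (t - 1) by rewrite ler_wpM2l// ltW.
have := sqr_ge0 t; rewrite ler_norml; move: h2 h3; rewrite mulrBr mulr1 -expr2 => h2 h3 ?.
by apply/andP; split; lra.
Qed.

Section window.
Variables (A B n m Z : R) (f d : R -> R).
Hypothesis AB : A < B.
Hypothesis n0 : 0 < n.
Hypothesis acf : abs_continuous_on A B f.
Hypothesis cf : continuous f.
Hypothesis fAB : forall x, ~~ (A < x < B) -> f x = 0.
Hypothesis fd : {ae lambda, forall x, is_derive x 1 f (d x)}.
Hypothesis m0 : 0 < m.
Hypothesis mE : (\int[lambda]_(x in `]A, B[) (f x ^+ 2 * p x)%:E = m%:E)%E.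
Hypothesis ZE : Z = F n - F (- n).
Hypothesis iKd : lambda.-integrable `]A, B[ (EFin \o (fun x => p x * (K x * d x) ^+ 2)).

Let Z0 : 0 < Z.
Proof. by rewrite ZE subr_gt0; apply: is_derive_gt0_lt dF p0 _; rewrite gtrN. Qed.

Let cg : continuous (fun x => f x ^+ 2 * p x).
Proof.
move=> x; apply: cvgM; last exact: cp.
by apply: (@cvg_comp _ _ _ f (fun y => y ^+ 2)); [exact: cf|exact: exprn_continuous].
Qed.

Let f2p0 x : 0 <= f x ^+ 2 * p x.
Proof. by rewrite mulr_ge0 ?sqr_ge0// ltW. Qed.

Let fp_eq0 x : ~~ (A < x < B) -> f x ^+ 2 * p x = 0.
Proof. by move=> /fAB ->; rewrite expr0n/= mul0r. Qed.

Lemma integral_itvoo_cc (h : R -> R) : measurable_fun setT h ->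
  (\int[lambda]_(x in `]A, B[) (h x)%:E = \int[lambda]_(x in `[A, B]) (h x)%:E)%E.
Proof.
move=> mh.
rewrite -[RHS]integral_itv_obnd_cbnd; last first.
  by apply/measurable_EFinP/measurable_funTS; exact: mh.
by rewrite -[RHS]integral_itv_bndo_bndc//; apply/measurable_EFinP/measurable_funTS; exact: mh.
Qed.

(** [Y] is the primitive of f^2 p rescaled by Z / m to run from [F (- n)] to [F n]. It stays in that
    range outside [A, B] because f vanishes there, so [T] exists on the whole line. *)
Lemma rearrangement_ex : exists2 T : R -> R, continuous T & forall x,
  is_derive x 1 T (Z * (f x ^+ 2 * p x) / m / p (T x)).
Proof.
have [G dG] := antiderivative_ex cg.
have GB : G B - G A = m.
  apply/EFin_inj; rewrite -(integral_is_derive dG cg (ltW AB)) -mE integral_itvoo_cc//.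
  exact: continuous_measurable_fun.
have GAB : G A <= G B by rewrite -subr_ge0 GB ltW.
have Gx x : G A <= G x <= G B.
  have [xA|/ltW Ax] := leP x A.
    suff <- : G A = G x by rewrite lexx.
    apply: is_derive_eq0_const dG xA _ => z /andP[_ zA].
    by rewrite fp_eq0// negb_and -!leNgt zA.
  have [Bx|/ltW xB] := leP B x.
    suff -> : G x = G B by rewrite lexx andbT.
    apply: is_derive_eq0_const dG Bx _ => z /andP[Bz _].
    by rewrite fp_eq0// negb_and -!leNgt Bz orbT.
  by rewrite !(is_derive_ge0_le dG).
pose Y x := F (- n) + Z / m * (G x - G A).
have dY (x : R) : is_derive x 1 Y (Z * (f x ^+ 2 * p x) / m).
  have D1 := is_derive_sub (dG x) (is_derive_cst (G A) x 1).
  have D2 := is_derive_mul (is_derive_cst (Z / m) x 1) D1.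
  apply: (is_derive_eq (is_derive_add (is_derive_cst (F (- n)) x 1) D2)).
  by rewrite /cst; ring.
have nn : - n <= n by rewrite ge0_cp// ltW.
have FY x : F (- n) <= Y x <= F n.
  have /andP[x1 x2] := Gx x; have Zm : 0 < Z / m by rewrite divr_gt0.
  rewrite /Y lerDl mulr_ge0 ?subr_ge0// ?(ltW Zm)//=.
  rewrite -lerBrDl -ZE (@le_trans _ _ (Z / m * m))//.
    by rewrite ler_pM2l// -GB lerD2r.
  by rewrite divfK// gt_eqF.
have [T _ dT] := monotone_rearrangement p0 dF nn FY dY.
exists T => //; exact: is_derive_continuous dT.
Qed.

(* The target measure is [mu] conditioned to [- n, n], so that the displacement
   [th] stays bounded and [H] vanishes at [A] and [B] without any tail estimate. *)
Lemma transport_window :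
  (\int[lambda]_(x in `]A, B[) (f x ^+ 2 * p x * ln (f x ^+ 2 / m)) + m * ln Z
   <= 2 / alpha * \int[lambda]_(x in `]A, B[) (p x * (K x * d x) ^+ 2))%R.
Proof.
have [T cT dT] := rearrangement_ex.
pose th x := phi (T x) - phi x.
pose dth x := Z * (f x ^+ 2 * p x) / m / p (T x) / K (T x) - (K x)^-1.
have dthE (x : R) : is_derive x 1 th (dth x).
  apply: is_derive_sub => //.
  by apply: (is_derive_eq (is_derive_comp (dphi (T x)) (dT x))); rewrite mulrC.
pose u x := k x * th x.
pose du x := - (v x * p x) * th x + k x * dth x.
have duE (x : R) : is_derive x 1 u (du x) by exact: is_derive_mul.
have cv : continuous v by exact: is_derive_continuous dvE.
have cth : continuous th by exact: is_derive_continuous dthE.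
have cinv (h : R -> R) : (forall x, 0 < h x) -> continuous h -> continuous (fun x => (h x)^-1).
  by move=> h0 ch x; apply: cvgV; [rewrite gt_eqF|exact: ch].
have ccomp (h : R -> R) : continuous h -> continuous (fun x => h (T x)).
  by move=> ch x; apply: continuous_comp; [exact: cT|exact: ch].
have cM (h1 h2 : R -> R) : continuous h1 -> continuous h2 -> continuous (fun x => h1 x * h2 x).
  by move=> c1 c2 x; apply: cvgM; [exact: c1|exact: c2].
have cdth : continuous dth.
  have cKT := cinv _ (fun x => K0 (T x)) (ccomp _ cK).
  have cpT := cinv _ (fun x => p0 (T x)) (ccomp _ cp).
  have cnum : continuous (fun x => Z * (f x ^+ 2 * p x) / m).
    by apply: (cM _ (cst m^-1)); [apply: (cM (cst Z)) => //; exact: cst_continuous|exact: cst_continuous].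
  move=> x; apply: cvgB; last exact: cinv.
  exact: (cM _ _ (cM _ _ cnum cpT) cKT).
have cdu : continuous du.
  have ck : continuous k by exact: is_derive_continuous dk.
  have cvp : continuous (fun x => - (v x * p x)).
    by move=> z; apply: cvgN; exact: (cM _ _ cv cp).
  by move=> x; apply: cvgD; [exact: (cM _ _ cvp cth)|exact: (cM _ _ ck cdth)].
(* [u] is continuously differentiable but f only absolutely continuous, so [H] is integrated through
   a density h that equals its derivative almost everywhere. *)
pose H x := u x * (f x * f x).
have acH : abs_continuous_on A B H.
  by apply: abs_continuous_onM; [exact: abs_continuous_on_C1 duE cdu|exact: abs_continuous_onM].
have [h [ih dh hE]] := abs_continuous_on_FTC AB acH.
have H0 : H B - H A = 0.
  by rewrite /H !fAB ?ltxx ?andbF// !mulr0 subrr.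
pose l1 x := f x ^+ 2 * p x * ln (f x ^+ 2 / m).
pose l2 x := f x ^+ 2 * p x * ln Z.
pose l3 x := 2 / alpha * (p x * (K x * d x) ^+ 2).
have lh : {ae lambda, forall x, x \in `]A, B[ -> l1 x + l2 x - l3 x <= h x}.
  apply: filterS2 dh fd; first exact: (ae_filter_ringOfSetsType lambda).
  move=> x dHx dfx xAB.
  have DH := is_derive_mul (duE x) (is_derive_mul dfx dfx).
  have -> : h x = du x * (f x * f x) + u x * (d x * f x + f x * d x).
    by have D1 := dHx xAB; rewrite -(@derive_val _ _ _ _ _ _ _ D1) (@derive_val _ _ _ _ _ _ _ DH).
  apply: le_trans (@transport_pointwise x (T x) (f x) (d x) Z m _ Z0 m0 (erefl _)) _.
  rewrite le_eqVlt; apply/orP; left; apply/eqP.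
  by rewrite /du /u -/(th x) /dth; ring.
pose D : set (measurableTypeR R) := `]A, B[%classic.
have mD : measurable D by exact: measurable_itv.
have mf : measurable_fun setT f by exact: continuous_measurable_fun.
have i1 : lambda.-integrable D (EFin \o l1).
  have [Mf Mf0 fM] := continuous_itv_bounded (ltW AB) cf.
  have [Mp Mp0 pM] := continuous_itv_bounded (ltW AB) cp.
  apply: measurable_bounded_integrable => //.
  - by rewrite /= lebesgue_measure_itv/=; case: ifP => _; rewrite ltry.
  - apply: measurable_funTS; apply: measurable_funM.
      by apply: continuous_measurable_fun; exact: cg.
    apply: measurableT_comp; first exact: measurable_ln.
    by apply: measurable_funM => //; exact: measurable_funX.
  exists (m * Mp * (1 + (Mf ^+ 2 / m) ^+ 2)); split; first exact: num_real.
  move=> C /ltW C0 x; rewrite /D /= in_itv/= => /andP[/ltW Ax /ltW xB]; apply: le_trans C0.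
  have -> : l1 x = m * (p x * (f x ^+ 2 / m * ln (f x ^+ 2 / m))).
    by rewrite /l1; field; rewrite gt_eqF.
  rewrite -[leRHS]mulrA normrM (gtr0_norm m0) ler_wpM2l ?(ltW m0)// normrM.
  apply: ler_pM => //; first by apply: pM; rewrite Ax.
  have t0 : 0 <= f x ^+ 2 / m by rewrite divr_ge0 ?sqr_ge0 ?ltW.
  apply: (le_trans (normr_xlnx_le t0)); rewrite lerD2l.
  have fx : `|f x| <= Mf by apply: fM; rewrite Ax.
  rewrite ler_pXn2r ?nnegrE//; last by rewrite divr_ge0 ?sqr_ge0 ?ltW.
  rewrite ler_pM2r ?invr_gt0// -[f x ^+ 2]real_normK ?num_real//.
  by rewrite ler_pXn2r ?nnegrE.
have ig : lambda.-integrable D (EFin \o (fun x => f x ^+ 2 * p x)).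
  exact: continuous_integrable_itv.
have i2 : lambda.-integrable D (EFin \o l2).
  by have := integrableZr mD (ln Z) ig; congr (_.-integrable _ _); apply/funext => x.
have i3 : lambda.-integrable D (EFin \o l3).
  by have := integrableZl mD (2 / alpha) iKd; congr (_.-integrable _ _); apply/funext => x.
have i12 : lambda.-integrable D (EFin \o (fun x => l1 x + l2 x)).
  exact: (integrableD mD i1 i2).
have il : lambda.-integrable D (EFin \o (fun x => l1 x + l2 x - l3 x)).
  exact: (integrableB mD i12 i3).
have ihD : lambda.-integrable D (EFin \o h) by exact: integrableS ih.
have hD : (\int[lambda]_(x in D) (h x)%:E = 0)%E.
  by rewrite integral_itvoo_cc ?hE ?H0//; apply/measurable_EFinP; exact: measurable_int ih.
(* The integrand is nonnegative only almost everywhere, hence the passage to its absolute value. *)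
have pos : (0 <= \int[lambda]_(x in D) ((h x)%:E - (l1 x + l2 x - l3 x)%:E))%E.
  rewrite (@ae_eq_integral _ _ _ lambda D (fun x => `|(h x)%:E - (l1 x + l2 x - l3 x)%:E|%E) _)//.
  - by apply: integral_ge0 => x _; exact: abse_ge0.
  - by apply: emeasurable_funB; [exact: measurable_int ihD|exact: measurable_int il].
  - apply: measurableT_comp => //.
    by apply: emeasurable_funB; [exact: measurable_int ihD|exact: measurable_int il].
  - apply: filterS lh; first exact: (ae_filter_ringOfSetsType lambda).
    move=> x hx Dx; rewrite gee0_abs// -EFinB lee_fin subr_ge0; apply: hx.
    by rewrite in_itv.
rewrite integralB_EFin// hD sub0e in pos.
have : (\int[lambda]_(x in D) (l1 x + l2 x - l3 x)%:E <= 0)%E.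
  by rewrite -oppe_ge0.
have -> : (\int[lambda]_(x in D) (l1 x + l2 x - l3 x)%:E =
   (\int[lambda]_(x in D) l1 x + m * ln Z - 2 / alpha * \int[lambda]_(x in D) (p x * (K x * d x) ^+ 2))%:E)%E.
  rewrite -[LHS]fineK; last exact: (integrable_fin_num mD il).
  congr EFin; rewrite -[LHS]/(\int[lambda]_(x in D) (l1 x + l2 x - l3 x))%R.
  rewrite RintegralB// RintegralD// /l2 /l3 RintegralZr// RintegralZl//.
  by rewrite [X in _ + X * _ - _]/Rintegral mE.
by rewrite lee_fin subr_le0.
Qed.
End window.
End transport_inequality.

(** * Entropy and the inequality for compactly supported functions *)

Section entropy_limit.
Context {R : realType}.
Variable mu : probability (measurableTypeR R) R.
Local Open Scope ereal_scope.

Lemma entropyE (g : R -> R) (m : R) : (0 <= m)%R -> 'E_mu[g] = m%:E ->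
  entropy mu g = 'E_mu[fun x => (g x * ln (g x))%R] - (m * ln m)%:E.
Proof.
(* At m = 0 the extended logarithm departs from [ln], but both products with 0 vanish. *)
move=> m0 gm; rewrite /entropy gm/=; case: ifPn => [m1|//].
have -> : m = 0%R by apply/le_anti/andP.
by rewrite !(mul0e, mul0r).
Qed.

Lemma entropy_sqr_eq0 (f : R -> R) : measurable_fun setT f ->
  'E_mu[fun x => (f x ^+ 2)%R] = 0 -> entropy mu (fun x => (f x ^+ 2)%R) = 0.
Proof.
move=> mf f0; rewrite (entropyE (lexx 0)) // mul0r sube0.
have mf2 : measurable_fun setT (fun x => f x ^+ 2)%R by exact: measurable_funX.
have mln : measurable_fun setT (fun x => f x ^+ 2 * ln (f x ^+ 2))%R.
  by apply: measurable_funM => //; apply: measurableT_comp => //; exact: measurable_ln.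
have fae : {ae mu, forall x, setT x -> (f x ^+ 2)%:E = 0%E}.
  apply/(ae_eq_integral_abs mu measurableT); first exact/measurable_EFinP.
  under eq_integral do rewrite gee0_abs ?lee_fin ?sqr_ge0//.
  by move: f0; rewrite unlock.
rewrite unlock (@ae_eq_integral _ _ _ mu setT (cst 0%E)) ?integral0//.
  exact/measurable_EFinP.
apply: filterS fae; first exact: (ae_filter_ringOfSetsType mu).
by move=> x /(_ Logic.I)[->] _; rewrite mul0r.
Qed.

(* Fatou's lemma, applied to [t ln t + 1], which is nonnegative. *)
Lemma entropy_sqr_limit (f : R -> R) (f_ : nat -> R -> R) (b_ : nat -> R) (b C : R) :
  measurable_fun setT f -> (forall n, measurable_fun setT (f_ n)) ->
  mu.-integrable setT (EFin \o (fun x => f x ^+ 2)%R) ->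
  (forall n, exists c, forall x, (`|f_ n x| <= c)%R) ->
  (forall n x, (`|f_ n x| <= C * `|f x|)%R) ->
  (forall x, f_ n x @[n --> \oo] --> f x) ->
  (forall n, entropy mu (fun x => (f_ n x ^+ 2)%R) <= (b_ n)%:E) ->
  b_ n @[n --> \oo] --> b -> (0 <= b)%R ->
  entropy mu (fun x => (f x ^+ 2)%R) <= b%:E.
Proof.
move=> mf mf_ if2 bf_ f_C cvf ent cvb b0.
pose g (h : R -> R) x := (h x ^+ 2 * ln (h x ^+ 2))%R.
have mg h : measurable_fun setT h -> measurable_fun setT (g h).
  move=> mh; have mh2 : measurable_fun setT (fun x => h x ^+ 2)%R by exact: measurable_funX.
  by apply: measurable_funM => //; apply: measurableT_comp => //; exact: measurable_ln.
(* For t > 0, ln (1/t) <= 1/t - 1 gives t ln t >= t - 1 > -1. *)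
have g1 h x : (0 <= g h x + 1)%R.
  rewrite /g; have [->|h0] := eqVneq (h x) 0%R; first by rewrite expr0n/= mul0r add0r ler01.
  have t0 : (0 < h x ^+ 2)%R by rewrite exprn_even_gt0.
  have ti0 : (0 < (h x ^+ 2)^-1)%R by rewrite invr_gt0.
  have := ln_le_subr1 ti0; rewrite lnV ?posrE// => hl.
  have := ler_wpM2l (ltW t0) hl; rewrite mulrN mulrBr divff ?gt_eqF// mulr1.
  by move=> h1; move: t0 h1; lra.
pose m := fine (\int[mu]_x (f x ^+ 2)%:E).
have mE : \int[mu]_x (f x ^+ 2)%:E = m%:E by rewrite fineK//; exact: integrable_fin_num if2.
have m0 : (0 <= m)%R by rewrite -lee_fin -mE; apply: integral_ge0 => x _; rewrite lee_fin sqr_ge0.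
(* A zero mean is set apart because m ln m is reached below through the continuity of [ln] at m. *)
have [m00|mneq0] := eqVneq m 0%R.
  by rewrite entropy_sqr_eq0 ?lee_fin// unlock mE m00.
have mgt0 : (0 < m)%R by rewrite lt_neqAle eq_sym mneq0.
have f2C n x : (f_ n x ^+ 2 <= C ^+ 2 * f x ^+ 2)%R.
  rewrite -exprMn -[leLHS]real_normK ?num_real// -[leRHS]real_normK ?num_real//.
  rewrite ler_pXn2r ?nnegrE// normrM (le_trans (f_C n x))//.
  by rewrite ler_wpM2r// ler_norm.
have mf2 (h : R -> R) : measurable_fun setT h -> measurable_fun setT (fun x => (h x ^+ 2)%R).
  by move=> mh; exact: measurable_funX.
have if_2 n : mu.-integrable setT (EFin \o (fun x => f_ n x ^+ 2)%R).
  have [c fc] := bf_ n; apply: (@bounded_integrable _ _ _ (c ^+ 2)); first exact: mf2.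
  move=> x; rewrite normrX ler_pXn2r ?nnegrE//.
  exact: le_trans (fc x).
have ig_ n : mu.-integrable setT (EFin \o g (f_ n)).
  have [c fc] := bf_ n.
  apply: (@bounded_integrable _ _ _ (1 + (c ^+ 2) ^+ 2)); first exact: mg.
  move=> x; apply: le_trans (normr_xlnx_le (sqr_ge0 _)) _; rewrite lerD2l.
  rewrite ler_pXn2r ?nnegrE ?sqr_ge0// -[leLHS]real_normK ?num_real//.
  by rewrite ler_pXn2r ?nnegrE// (le_trans _ (fc x)).
pose m_ n := fine (\int[mu]_x (f_ n x ^+ 2)%:E).
have m_E n : \int[mu]_x (f_ n x ^+ 2)%:E = (m_ n)%:E.
  by rewrite fineK//; exact: integrable_fin_num (if_2 n).
have m_0 n : (0 <= m_ n)%R.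
  by rewrite -lee_fin -m_E; apply: integral_ge0 => x _; rewrite lee_fin sqr_ge0.
have cvm : m_ n @[n --> \oo] --> m.
  have [|||||_ _ c1] := @dominated_convergence _ _ _ mu setT measurableT
    (fun n x => (f_ n x ^+ 2)%:E) (fun x => (f x ^+ 2)%:E) (fun x => (C ^+ 2)%:E * (f x ^+ 2)%:E).
  - by move=> n; apply/measurable_EFinP; exact: mf2.
  - by apply/measurable_EFinP; exact: mf2.
  - apply: aeW => x _; apply: cvg_EFin; first exact: nearW.
    by apply: (@cvg_comp _ _ _ (f_ ^~ x) (fun y => y ^+ 2)%R); [exact: cvf|exact: exprn_continuous].
  - exact: integrableZl.
  - by apply: aeW => x n _; rewrite /= ger0_norm ?sqr_ge0// -EFinM lee_fin.
  by apply: fine_cvg; rewrite -mE.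
have G_le n : \int[mu]_x (g (f_ n) x + 1)%:E <= (m_ n * ln (m_ n) + b_ n + 1)%:E.
  under eq_integral do rewrite EFinD.
  rewrite integralD_EFin//; last exact: finite_measure_integrable_cst.
  rewrite integral_cst//= mul1e probability_setT EFinD leeD2r//.
  have := ent n; rewrite (entropyE (m_0 n)) ?unlock ?m_E// leeBlDr// addeC -EFinD.
  by [].
have cvR : (m_ n * ln (m_ n) + b_ n + 1)%R @[n --> \oo] --> (m * ln m + b + 1)%R.
  apply: cvgD; last exact: cvg_cst.
  apply: cvgD => //; apply: cvgM => //.
  by apply: continuous_cvg => //; exact: continuous_ln.
have cvg_g x : (g (f_ n) x + 1)%:E @[n --> \oo] --> (g f x + 1)%:E.
  apply: cvg_EFin; first exact: nearW.
  apply: cvgD; last exact: cvg_cst.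
  have cv2 : (f_ n x ^+ 2)%R @[n --> \oo] --> (f x ^+ 2)%R.
    by apply: (@cvg_comp _ _ _ (f_ ^~ x) (fun y => y ^+ 2)%R); [exact: cvf|exact: exprn_continuous].
  (* Where f vanishes, domination by a multiple of |f| forces every [f_ n] to vanish too, which
     avoids the singularity of [ln] at 0. *)
  have [fx0|fx0] := eqVneq (f x) 0%R.
    rewrite (_ : (fun n => _) = cst (g f x)); first exact: cvg_cst.
    apply/funext => n; rewrite /g fx0 (_ : f_ n x = 0%R)//.
    by apply/eqP; rewrite -normr_le0 (le_trans (f_C n x))// fx0 normr0 mulr0.
  apply: cvgM => //; apply: continuous_cvg => //; apply: continuous_ln.
  by rewrite exprn_even_gt0.
have F := @fatou _ _ _ mu setT measurableT (fun n x => (g (f_ n) x + 1)%:E).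
have {}F : \int[mu]_x (g f x + 1)%:E <= (m * ln m + b + 1)%:E.
  apply: (@le_trans _ _ (limn_einf (fun n => \int[mu]_x (g (f_ n) x + 1)%:E))).
    rewrite (_ : \int[mu]_x (g f x + 1)%:E = \int[mu]_x limn_einf (fun n => (g (f_ n) x + 1)%:E)).
      apply: F => // n; last by move=> x _; rewrite lee_fin.
      by apply/measurable_EFinP; apply: measurable_funD => //; exact: mg.
    by apply: eq_integral => x _; rewrite (cvg_limn_einf_sup (cvg_g x)).
  have cvR' : (m_ n * ln (m_ n) + b_ n + 1)%:E @[n --> \oo] --> (m * ln m + b + 1)%:E.
    by apply: cvg_EFin => //; exact: nearW.
  rewrite limn_einf_lim -(cvg_lim _ cvR')//; apply: lee_lim.
  - exact: is_cvg_einfs.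
  - by apply/cvg_ex; exists (m * ln m + b + 1)%:E.
  - apply: nearW => n; apply: le_trans (G_le n).
    by apply: ereal_inf_lbound; exists n => /=.
have mg1 : measurable_fun setT (fun x => g f x + 1)%R by apply: measurable_funD => //; exact: mg.
(* The Fatou bound also proves integrability, which allows the constant 1 to be split off again. *)
have ig1 : mu.-integrable setT (EFin \o (fun x => g f x + 1)%R).
  apply/integrableP; split; first exact/measurable_EFinP.
  under eq_integral do rewrite /= ger0_norm//.
  by apply: le_lt_trans F _; exact: ltry.
have i1 : mu.-integrable setT (EFin \o (cst 1%R)) by exact: finite_measure_integrable_cst.
rewrite (entropyE m0) ?unlock// leeBlDr// -EFinD.
have -> : \int[mu]_x (f x ^+ 2 * ln (f x ^+ 2))%:E =
    \int[mu]_x (g f x + 1)%:E - 1.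
  transitivity (\int[mu]_x ((g f x + 1)%:E - (cst 1%R x)%:E)).
    by apply: eq_integral => x _; rewrite -EFinB /= addrK.
  rewrite integralB_EFin//; congr (_ - _).
  by rewrite /= integral_cst// mul1e; exact: probability_setT.
rewrite leeBlDr// (le_trans F)// -EFinD lee_fin.
by rewrite [(b + _)%R]addrC.
Qed.

End entropy_limit.

Section density_integral.
Context {R : realType}.
Notation lambda := (@lebesgue_measure R).
Variables (mu : probability (measurableTypeR R) R) (p F : R -> R).
Hypothesis p0 : forall x, 0 < p x.
Hypothesis cp : continuous p.
Hypothesis dF : forall x : R, is_derive x 1 F (p x).
Hypothesis muE : forall x y, x < y -> mu `]x, y[%classic = (F y - F x)%:E.

Lemma integral_density (g : R -> R) : measurable_fun setT g ->
  (\int[mu]_x (g x)%:E = \int[lambda]_x (g x * p x)%:E)%E.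
Proof.
move=> mg; have pge0 x := ltW (p0 x).
have mge : measurable_fun [set: measurableTypeR R] (EFin \o g) by exact/measurable_EFinP.
rewrite integralE [RHS]integralE; congr (_ - _)%E.
  rewrite (ge0_integral_density pge0 cp dF muE)//; last exact: measurable_funepos.
  apply: eq_integral => x _.
  by rewrite !funeposE maxe_pMl ?mul0e// lee_fin.
rewrite (ge0_integral_density pge0 cp dF muE)//; last exact: measurable_funeneg.
apply: eq_integral => x _.
by rewrite !funenegE maxe_pMl ?mul0e ?lee_fin// -EFinN -EFinM mulNr.
Qed.

Lemma cvg_density_window : (F n.+1%:R - F (- n.+1%:R)) @[n --> \oo] --> (1 : R).
Proof.
have cv : mu `](- n%:R), n%:R[%classic @[n --> \oo] --> 1%E.
  rewrite -(probability_setT mu) -(bigcup_itvT false true).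
  apply: nondecreasing_cvg_mu => //; first exact: bigcup_measurable.
  by move=> *; apply/subsetPset/subset_itv; rewrite leBSide/= ?lerN2 ler_nat.
have cvS : mu `](- n.+1%:R), n.+1%:R[%classic @[n --> \oo] --> 1%E.
  by rewrite (cvg_shiftS (fun n => mu `](- n%:R), n%:R[%classic)).
rewrite (_ : (fun n => _) = fine \o (fun n => mu `](- n.+1%:R), n.+1%:R[%classic)).
  exact: fine_cvg.
by apply/funext => n /=; rewrite muE// gtrN.
Qed.

End density_integral.

Section lsi_compact_support.
Context {R : realType}.
Notation lambda := (@lebesgue_measure R).
Implicit Types x y z : R.
Variables (mu : probability (measurableTypeR R) R).
Variables (k v dv K phi p F : R -> R) (alpha : R).
Hypothesis alpha0 : 0 < alpha.
Hypothesis K0 : forall x, 0 < K x.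
Hypothesis cK : continuous K.
Hypothesis p0 : forall x, 0 < p x.
Hypothesis cp : continuous p.
Hypothesis dF : forall x, is_derive x 1 F (p x).
Hypothesis muE : forall x y, x < y -> mu `]x, y[%classic = (F y - F x)%:E.
Hypothesis kE : forall x, k x = K x * p x.
Hypothesis dk : forall x, is_derive x 1 k (- (v x * p x)).
Hypothesis dphi : forall x, is_derive x 1 phi (K x)^-1.
Hypothesis dvE : forall x, is_derive x 1 v (dv x).
Hypothesis alphaE : forall x, alpha <= K x * dv x.

Variables (A B : R) (f d : R -> R).
Hypothesis AB : A < B.
Hypothesis acf : abs_continuous_on A B f.
Hypothesis cf : continuous f.
Hypothesis fAB : forall x, ~~ (A < x < B) -> f x = 0.
Hypothesis dAB : forall x, ~~ (A < x < B) -> d x = 0.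
Hypothesis md : measurable_fun setT d.
Hypothesis fd : {ae lambda, forall x, is_derive x 1 f (d x)}.

Let D : set (measurableTypeR R) := `]A, B[%classic.

Let mf : measurable_fun setT f.
Proof. exact: continuous_measurable_fun. Qed.

Lemma integral_density_support (g : R -> R) : measurable_fun setT g ->
  (forall x, ~~ (A < x < B) -> g x = 0) ->
  (\int[mu]_x (g x)%:E = \int[lambda]_(x in D) (g x * p x)%:E)%E.
Proof.
move=> mg gAB; rewrite (integral_density p0 cp dF muE)// [RHS]integral_mkcond.
apply: eq_integral => x _; rewrite patchE /D; case: ifPn => // xD.
rewrite gAB ?mul0r//; apply: contra xD => xAB.
by rewrite inE /= in_itv.
Qed.

(** [d] is any measurable almost everywhere derivative that vanishes off the window, so the
    truncated functions of the corollary fit, with [d] given by the product rule. *)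
Lemma lsi_compact_support :
  (entropy mu (fun x => (f x ^+ 2)%R) <=
   (2 / alpha)%:E * 'E_mu[fun x => ((K x * d x) ^+ 2)%R])%E.
Proof.
have mK : measurable_fun setT K by exact: continuous_measurable_fun.
have mKd : measurable_fun setT (fun x => (K x * d x) ^+ 2).
  by apply: measurable_funX; exact: measurable_funM.
have mf2 : measurable_fun setT (fun x => f x ^+ 2) by exact: measurable_funX.
have mln : measurable_fun setT (fun x => f x ^+ 2 * ln (f x ^+ 2)).
  by apply: measurable_funM => //; apply: measurableT_comp => //; exact: measurable_ln.
have a20 : 0 < 2 / alpha by rewrite divr_gt0.
have [Mf Mf0 fM] := continuous_itv_bounded (ltW AB) cf.
have fMT x : `|f x| <= Mf.
  have [/andP[/ltW Ax /ltW xB]|/fAB ->] := boolP (A < x < B); last by rewrite normr0.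
  by apply: fM; rewrite Ax.
have f2M x : f x ^+ 2 <= Mf ^+ 2.
  by rewrite -[f x ^+ 2]real_normK ?num_real// ler_pXn2r ?nnegrE.
have if2 : mu.-integrable setT (EFin \o (fun x => f x ^+ 2)).
  by apply: (@bounded_integrable _ _ _ (Mf ^+ 2)) => // x; rewrite ger0_norm ?sqr_ge0.
pose m := (\int[mu]_x (f x ^+ 2)%:E)%E.
have mfin : m \is a fin_num by exact: integrable_fin_num.
have m0 : (0 <= m)%E by apply: integral_ge0 => x _; rewrite lee_fin sqr_ge0.
pose E := (\int[mu]_x ((K x * d x) ^+ 2)%:E)%E.
have E0 : (0 <= E)%E by apply: integral_ge0 => x _; rewrite lee_fin sqr_ge0.
have iln : mu.-integrable setT (EFin \o (fun x => f x ^+ 2 * ln (f x ^+ 2))).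
  apply: (@bounded_integrable _ _ _ (1 + (Mf ^+ 2) ^+ 2)) => // x.
  apply: le_trans (normr_xlnx_le (sqr_ge0 _)) _; rewrite lerD2l.
  by rewrite ler_pXn2r ?nnegrE ?sqr_ge0.
have mE : m = (fine m)%:E by rewrite fineK.
have [m00|mneq0] := eqVneq (fine m) 0.
  have m0E : ('E_mu[fun x => (f x ^+ 2)%R] = 0)%E by rewrite unlock -/m mE m00.
  by rewrite (entropy_sqr_eq0 mf m0E) unlock mule_ge0// lee_fin ltW.
have mgt0 : 0 < fine m by rewrite lt_neqAle eq_sym mneq0 fine_ge0.
(* An infinite right side leaves nothing to prove; a finite one supplies the integrability that the
   window inequality asks for. *)
have [Eoo|Efin] := eqVneq E +oo%E.
  by rewrite unlock -/E Eoo gt0_muley ?lte_fin// leey.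
have {}Efin : E \is a fin_num by rewrite ge0_fin_numE// ltey.
have f20 x : ~~ (A < x < B) -> f x ^+ 2 = 0 by move=> /fAB ->; rewrite expr0n.
have fln0 x : ~~ (A < x < B) -> f x ^+ 2 * ln (f x ^+ 2) = 0.
  by move=> /f20 ->; rewrite mul0r.
have Kd0 x : ~~ (A < x < B) -> (K x * d x) ^+ 2 = 0.
  by move=> /dAB ->; rewrite mulr0 expr0n.
have mED : (\int[lambda]_(x in D) (f x ^+ 2 * p x)%:E = (fine m)%:E)%E.
  by rewrite -mE -integral_density_support.
have EE : (\int[lambda]_(x in D) ((K x * d x) ^+ 2 * p x)%:E = E)%E.
  by rewrite -integral_density_support.
have mp : measurable_fun setT p by exact: continuous_measurable_fun.
have iKd : lambda.-integrable D (EFin \o (fun x => p x * (K x * d x) ^+ 2)).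
  apply/integrableP; split.
    by apply/measurable_EFinP/measurable_funTS; exact: measurable_funM.
  rewrite (_ : (\int[lambda]_(x in D) _)%E = E) ?ltey_eq ?Efin//.
  rewrite -EE; apply: eq_integral => x _.
  by rewrite /= mulrC ger0_norm// mulr_ge0 ?sqr_ge0// ltW.
pose L := (\int[mu]_x (f x ^+ 2 * ln (f x ^+ 2))%:E)%E.
have Lfin : L \is a fin_num by exact: integrable_fin_num iln.
have LE : (\int[lambda]_(x in D) (f x ^+ 2 * ln (f x ^+ 2) * p x)%:E = L)%E.
  by rewrite -integral_density_support.
have mD : measurable D by exact: measurable_itv.
have igD : lambda.-integrable D (EFin \o (fun x => f x ^+ 2 * p x)).
  apply/integrableP; split.
    by apply/measurable_EFinP/measurable_funTS; exact: measurable_funM.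
  rewrite (_ : (\int[lambda]_(x in D) _)%E = (fine m)%:E) ?ltry//.
  rewrite -mED; apply: eq_integral => x _.
  by rewrite /= ger0_norm// mulr_ge0 ?sqr_ge0// ltW.
have igm : lambda.-integrable D (EFin \o (fun x => f x ^+ 2 * p x * ln (fine m))).
  by have := integrableZr mD (ln (fine m)) igD; congr (_.-integrable _ _); apply/funext => x.
have ilnD : lambda.-integrable D (EFin \o (fun x => f x ^+ 2 * ln (f x ^+ 2) * p x)).
  apply/integrableP; split.
    by apply/measurable_EFinP/measurable_funTS; exact: measurable_funM.
  move/integrableP : iln => [_]; congr (_ < _)%E.
  rewrite /= (@integral_density_support (fun x => `|f x ^+ 2 * ln (f x ^+ 2)|)).
  - by apply: eq_integral => x _; rewrite /= [`|_ * p x|]normrM (gtr0_norm (p0 x)).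
  - exact: measurableT_comp.
  - by move=> x /fln0 ->; rewrite normr0.
have W n : fine L - fine m * ln (fine m) + fine m * ln (F n.+1%:R - F (- n.+1%:R)) <= 2 / alpha * fine E.
  have := transport_window alpha0 K0 cK p0 cp dF kE dk dphi dvE alphaE AB (ltr0Sn R n)
    acf cf fAB fd mgt0 mED erefl iKd.
  congr (_ + _ <= _ * _).
    transitivity (\int[lambda]_(x in D) (f x ^+ 2 * ln (f x ^+ 2) * p x - f x ^+ 2 * p x * ln (fine m)))%R.
      (* Splitting the logarithm requires f nonzero; where f is 0 both integrands vanish. *)
      apply: eq_Rintegral => x _; have [->|fx0] := eqVneq (f x) 0.
        by rewrite expr0n/= !mul0r subr0.
      rewrite ln_div ?posrE ?exprn_even_gt0//; ring.
    rewrite RintegralB//.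
    rewrite RintegralZr// /Rintegral LE mED/=; ring.
  rewrite /Rintegral -EE; congr fine; apply: eq_integral => x _; congr EFin; ring.
rewrite (entropyE (ltW mgt0)) ?unlock// -/E -/L -(fineK Lfin) -(fineK Efin).
rewrite -EFinM -EFinB lee_fin.
have c1 : fine L - fine m * ln (fine m) + fine m * ln (F n.+1%:R - F (- n.+1%:R)) @[n --> \oo]
   --> fine L - fine m * ln (fine m) + fine m * ln 1.
  apply: cvgD; first exact: cvg_cst.
  apply: cvgM; first exact: cvg_cst.
  apply: continuous_cvg; first by apply: continuous_ln; exact: ltr01.
  exact: (cvg_density_window muE).
rewrite ln1 mulr0 addr0 in c1.
apply: (ler_cvg_to c1 (cvg_cst (2 / alpha * fine E))).
exact: nearW.
Qed.

End lsi_compact_support.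

Section abs_continuous_on_the_line.
Context {R : realType}.
Notation lambda := (@lebesgue_measure R).

Lemma abs_continuous_continuous (f : R -> R) : abs_continuous f -> continuous f.
Proof.
move=> acf x; apply/cvgrPdist_lt => e e0.
have [d d0 H] := acf (x - 1) (x + 1) e e0.
have H1 s t : x - 1 <= s -> s <= t -> t <= x + 1 -> t - s < d -> `|f t - f s| < e.
  move=> xs st tx std; have := H 1%N (fun=> s) (fun=> t).
  rewrite !big_ord1; apply => //.
  by apply/trivIsetP => j k _ _; rewrite !ord1 eqxx.
near=> y.
have y1 : `|x - y| <= 1 by near: y; apply: cvgr_dist_le => //; exact: cvg_id.
have yd : `|x - y| < d by near: y; apply: cvgr_dist_lt => //; exact: cvg_id.
move: y1 yd; rewrite ler_norml ltr_norml => /andP[? ?] /andP[? ?].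
have [xy|/ltW yx] := leP x y.
  by rewrite distrC; apply: H1 => //; lra.
by apply: H1 => //; lra.
Unshelve. all: by end_near. Qed.

(** Countably many windows exhaust the line, each with its own null set; [derive1 f] replaces the
    density, which depends on the window. *)
Lemma abs_continuous_ae_derive (f : R -> R) : abs_continuous f ->
  {ae lambda, forall x : R, is_derive x 1 f (derive1 f x)}.
Proof.
move=> acf.
have H n : \forall x \ae lambda, x \in `](- n.+1%:R), n.+1%:R[ -> is_derive (x : R) 1 f (derive1 f x).
  have nn : - n.+1%:R < n.+1%:R :> R by rewrite gtrN.
  have [h [_ dh _]] := abs_continuous_on_FTC nn (acf (- n.+1%:R) n.+1%:R).
  apply: filterS dh; first exact: (ae_filter_ringOfSetsType lambda).
  by move=> x hx /hx D; apply: derivable_is_derive; exact: ex_derive.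
have [N [mN N0 sN]] := ae_foralln H.
exists N; split => // x nx; apply: sN => Hx; apply: nx.
have bS : (Num.bound x)%:R < (Num.bound x).+1%:R :> R by rewrite ltr_nat.
apply: (Hx (Num.bound x)); rewrite in_itv/=; apply/andP; split.
  by rewrite ltrNl; exact: (lt_trans (unstable.ltrNbound x) bS).
exact: (lt_trans (unstable.ltr_bound x) bS).
Qed.

End abs_continuous_on_the_line.

(** * From the hypotheses on mu, K and v to the density setting *)

Section lsi_gradient.
Context {R : realType}.
Notation lambda := (@lebesgue_measure R).
Variables (mu : probability (measurableTypeR R) R).
Variables (vmu v K a : R -> R) (alpha : R).
Hypothesis hvmu : is_log_gradient mu vmu.
Hypothesis hv : is_divergence mu K v.
Hypothesis halpha : 0 < alpha.
Hypothesis hv_diff : forall x : R, derivable v x 1.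
Hypothesis hKv : forall x, alpha <= K x * derive1 v x.
Hypothesis ha : forall x, a x = 2 * K x * derive1 K x + K x ^+ 2 * vmu x.
Hypothesis hK_smooth : smooth K.
Hypothesis ha_smooth : smooth a.

Let K_neq0 x : K x != 0.
Proof. by apply/eqP => Kx; have := hKv x; rewrite Kx mul0r leNgt halpha. Qed.

Let cK : continuous K. Proof. exact: smooth_continuous. Qed.

Let vmuE : vmu = (a \+ (cst (- 2) \* K \* derive1 K)) \* (fun x => (K x)^-1 * (K x)^-1).
Proof. by apply/funext => x /=; rewrite ha; field; exact: K_neq0. Qed.

Let smooth_vmu : smooth vmu.
Proof.
apply/smoothP => n; rewrite vmuE.
have sK := (smoothP K).1 hK_smooth n.
have sK' := (smoothP (derive1 K)).1 (smooth_derive1 hK_smooth) n.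
have sa := (smoothP a).1 ha_smooth n.
have sKi := smoothn_inv K_neq0 sK.
have s1 := smoothnM (smoothnM (@smoothn_cst R n (- 2)) sK) sK'.
have s2 := smoothnM (smoothnD sa s1) (smoothnM sKi sKi).
exact: s2.
Qed.

Let K_sign : (forall x, 0 < K x) \/ (forall x, K x < 0).
Proof.
have H x y : 0 < K x -> K y < 0 -> False.
  move=> Kx Ky.
  have [xy|/ltW yx] := leP x y.
    have [|c _ Kc] := @IVT _ K x y 0 xy (continuous_subspaceT cK).
      by rewrite ge_min le_max (ltW Kx) (ltW Ky) ?orbT.
    by have := K_neq0 c; rewrite Kc eqxx.
  have [|c _ Kc] := @IVT _ K y x 0 yx (continuous_subspaceT cK).
    by rewrite ge_min le_max (ltW Kx) (ltW Ky) ?orbT.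
  by have := K_neq0 c; rewrite Kc eqxx.
have [K0|K0|/eqP] := ltgtP (K 0) 0; last by rewrite (negbTE (K_neq0 0)).
  right => x; have [//|Kx|/eqP] := ltgtP (K x) 0; last by rewrite (negbTE (K_neq0 x)).
  by case: (H x 0).
left => x; have [Kx|//|/eqP] := ltgtP (K x) 0; last by rewrite (negbTE (K_neq0 x)).
by case: (H 0 x).
Qed.

Lemma lsi_gradient (A B : R) (f d : R -> R) : A < B ->
  abs_continuous_on A B f -> continuous f ->
  (forall x, ~~ (A < x < B) -> f x = 0) ->
  (forall x, ~~ (A < x < B) -> d x = 0) ->
  measurable_fun setT d ->
  {ae lambda, forall x : R, is_derive x 1 f (d x)} ->
  (entropy mu (fun x => (f x ^+ 2)%R) <=
   (2 / alpha)%:E * 'E_mu[fun x => ((K x * d x) ^+ 2)%R])%E.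
Proof.
move=> AB acf cf fAB dAB md fd.
have cvmu : continuous vmu by exact: smooth_continuous.
have [Q dQ] := antiderivative_ex cvmu.
have sQ := smooth_antiderivative dQ smooth_vmu.
have [c [F [c0 dF muE]]] := log_gradient_density hvmu sQ dQ.
pose p x := c * expR (Q x).
have p0 x : 0 < p x by rewrite mulr_gt0 ?expR_gt0.
have dp (x : R) : is_derive x 1 p (vmu x * p x).
  have := is_derive_mul (is_derive_cst c x 1) (is_derive_exp (dQ x)).
  by move=> D; apply: (is_derive_eq D); rewrite /cst /p; ring.
have cp : continuous p by exact: is_derive_continuous dp.
have mu_gt0 x y : x < y -> (0 < mu `]x, y[%classic)%E.
  by move=> xy; rewrite muE// lte_fin subr_gt0 (is_derive_gt0_lt dF p0 xy).
have dv (x : R) : is_derive x 1 v (derive1 v x) by exact: derivable_is_derive.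
have cv : continuous v by exact: is_derive_continuous dv.
have vE := divergenceE mu_gt0 hvmu hv cvmu cv hK_smooth.
have dKp (x : R) : is_derive x 1 (fun x => K x * p x) (- (v x * p x)).
  apply: (is_derive_eq (is_derive_mul (smooth_is_derive x hK_smooth) (dp x))).
  by rewrite vE; ring.
have cKi (h : R -> R) : (forall x, h x != 0) -> continuous h -> continuous (fun x => (h x)^-1).
  by move=> h0 ch x; apply: cvgV; [exact: h0|exact: ch].
case: K_sign => K0.
  have [phi dphi] := antiderivative_ex (cKi _ K_neq0 cK).
  exact: (lsi_compact_support halpha K0 cK p0 cp dF muE (fun=> erefl) dKp dphi dv hKv AB).
(* For negative [K] the pair (- K, - v) takes over: K v' and (K d)^2 are unchanged, and k changes
   sign. *)
have NK0 x : 0 < - K x by rewrite oppr_gt0.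
have cNK : continuous (fun x => - K x) by move=> x; apply: cvgN; exact: cK.
have [phi dphi] := antiderivative_ex (cKi _ (fun x => lt0r_neq0 (NK0 x)) cNK).
have dNv (x : R) : is_derive x 1 (fun x => - v x) (- derive1 v x) by exact: is_derive_opp.
have dNk (x : R) : is_derive x 1 (fun x => - K x * p x) (- (- v x * p x)).
  have -> : (fun x => - K x * p x) = (fun x => - (K x * p x)) by apply/funext => z; rewrite mulNr.
  by apply: (is_derive_eq (is_derive_opp (dKp x))); rewrite mulNr.
have hNKv x : alpha <= - K x * - derive1 v x by rewrite mulrNN.
have := lsi_compact_support halpha NK0 cNK p0 cp dF muE (fun=> erefl) dNk dphi dNv hNKv AB
  acf cf fAB dAB md fd.
congr (_ <= _ * _)%E; congr expectation; apply/funext => x.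
by rewrite mulNr sqrrN.
Qed.

End lsi_gradient.

(** * Removing the compact support *)

Section cutoff.
Context {R : realType}.

(** Normalised to 1 at 0, the value that survives when x / n tends to 0. *)
Definition cutoff (x : R) : R := bump (-1) 1 0 x / bump (-1) 1 0 0.

Lemma smooth_cutoff : smooth cutoff.
Proof.
have -> : cutoff = bump (-1) 1 0 \* cst (bump (-1) 1 0 0)^-1 by apply/funext.
apply/smoothP => n; apply: smoothnM; last exact: smoothn_cst.
exact: ((smoothP _).1 (@smooth_bump R (-1) 1 0) n).
Qed.

Lemma cutoff0 : cutoff 0 = 1.
Proof. by rewrite /cutoff divff// gt_eqF// bump_gt0//; apply/andP; split; lra. Qed.

Lemma cutoff_support x : ~~ (- 1 < x < 1) -> cutoff x = 0.
Proof. by move=> x1; rewrite /cutoff bump_eq0// mul0r. Qed.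

Lemma cutoff_derive1_support x : ~~ (- 2 < x < 2) -> derive1 cutoff x = 0.
Proof.
move=> x2; apply: (@derive_support _ cutoff (derive1 cutoff) 1).
- by move=> y; apply: smooth_is_derive; exact: smooth_cutoff.
- exact: cutoff_support.
- by move: x2; congr (~~ (_ < _ < _)); lra.
Qed.

Lemma cutoff_bounded : exists2 C : R, 0 <= C &
  forall x, `|cutoff x| <= C /\ `|derive1 cutoff x| <= C.
Proof.
have [C1 H1] := continuous_support_bounded ltr01
  (smooth_continuous smooth_cutoff) cutoff_support.
have [C2 H2] := continuous_support_bounded (ltr0n R 2)
  (smooth_continuous (smooth_derive1 smooth_cutoff)) cutoff_derive1_support.
exists (Num.max C1 C2).
  by rewrite le_max (le_trans _ (H1 0)).
by move=> x; rewrite !le_max H1 H2 orbT.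
Qed.

End cutoff.

Theorem theorem3 (R : realType) (mu : probability (measurableTypeR R) R)
    (vmu v K a : R -> R) (alpha : R)
    (hvmu : is_log_gradient mu vmu)
    (hv : is_divergence mu K v)
    (halpha : 0 < alpha)
    (hv_diff : forall x, derivable v x 1)
    (hKv : forall x, alpha <= K x * derive1 v x)
    (ha : forall x, a x = 2 * K x * derive1 K x + K x ^+ 2 * vmu x)
    (hK_smooth : smooth K) (ha_smooth : smooth a)
    (hK_lin : growth_at_infty 1 K) (ha_lin : growth_at_infty 1 a)
    (hK_poly : derivatives_poly_growth K)
    (ha_poly : derivatives_poly_growth a) :
  (forall f : R -> R, test_function f ->
     (entropy mu (fun x => (f x ^+ 2)%R)
      <= (2 / alpha)%:E * 'E_mu[fun x => ((K x * derive1 f x) ^+ 2)%R])%E)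
  /\
  (bounded_fun K ->
   forall f : R -> R, abs_continuous f ->
     f \in Lfun mu 2%:E -> derive1 f \in Lfun mu 2%:E ->
     (entropy mu (fun x => (f x ^+ 2)%R)
      <= (2 / alpha * sup (range (fun x => (K x ^+ 2)%R)))%:E
         * 'E_mu[fun x => (derive1 f x ^+ 2)%R])%E).
Proof.
have lsi := lsi_gradient hvmu hv halpha hv_diff hKv ha hK_smooth ha_smooth.
split=> [f /test_functionP[sf [M M0 fM]]|[N [_ KN]] f acf L2f L2df].
  have df (x : R) := smooth_is_derive x sf.
  have cdf := smooth_continuous (smooth_derive1 sf).
  (* The extra unit is the margin of [derive_support], by which the derivative vanishes off the
     window too. *)
  apply: (lsi (- (M + 1)) (M + 1)).
  - by rewrite gtrN// addr_gt0.
  - exact: abs_continuous_on_C1 df cdf.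
  - exact: smooth_continuous.
  - by move=> x xM; apply: fM; apply: contra xM => /andP[? ?]; apply/andP; split; lra.
  - exact: derive_support df fM.
  - exact: continuous_measurable_fun.
  - exact: aeW.
have cf := abs_continuous_continuous acf.
pose d : R -> R := derive1 f.
have aed := abs_continuous_ae_derive acf.
have if2 := Lfun2_integrable_sqr L2f.
have id2 : mu.-integrable setT (EFin \o (fun x => d x ^+ 2)) := Lfun2_integrable_sqr L2df.
have mf : measurable_fun setT f by exact: continuous_measurable_fun.
(* Absolute continuity controls [derive1 f] only almost everywhere, so its Borel measurability is
   read off from the membership in [Lfun]. *)
have md : measurable_fun setT d.
  by move: L2df; rewrite inE => /andP[]; rewrite inE.
pose S := sup (range (fun x => K x ^+ 2)).
have KS x : K x ^+ 2 <= S.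
  apply: ub_le_sup; last by exists x.
  exists ((N + 1) ^+ 2) => _ [y _ <-].
  have KN1 : `|K y| <= N + 1 by apply: KN => //; rewrite ltrDl.
  rewrite -[K y ^+ 2]real_normK ?num_real// ler_pXn2r ?nnegrE//.
  exact: le_trans KN1.
have S0 : 0 <= S by apply: le_trans (KS 0); exact: sqr_ge0.
have a0 : 0 <= 2 / alpha by rewrite divr_ge0// ltW.
have [C C0 cC] := @cutoff_bounded R.
pose eta n x : R := cutoff (x / n.+1%:R).
pose deta n x : R := derive1 cutoff (x / n.+1%:R) / n.+1%:R.
have sc := @smooth_cutoff R.
have deta_is n (x : R) : is_derive x 1 (eta n) (deta n x).
  have D := is_derive_mul (is_derive_id x 1) (is_derive_cst (n.+1%:R^-1 : R) x 1).
  apply: (is_derive_eq (@is_derive_comp _ cutoff (fun y => y / n.+1%:R) x _ _ (smooth_is_derive (x / n.+1%:R) sc) D)).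
  by rewrite /deta /cst; ring.
have scale n (h : R -> R) : continuous h -> continuous (fun x : R => h (x / n.+1%:R)).
  move=> ch x; apply: (@continuous_comp _ _ _ (fun y : R => y / n.+1%:R) h); last exact: ch.
  by apply: cvgM; [exact: cvg_id|exact: cvg_cst].
have cdc := smooth_continuous (smooth_derive1 sc).
have cdeta n : continuous (deta n).
  by move=> x; apply: cvgM; [exact: scale|exact: cvg_cst].
have Nn n : 0 < n.+1%:R :> R by [].
(* The window is twice as wide as the support of the scaled cutoff, to match the interval ]-2, 2[
   off which the derivative of [cutoff] is known to vanish. *)
have eta0 n x : ~~ (- (2 * n.+1%:R) < x < 2 * n.+1%:R) -> eta n x = 0.
  move=> xn; apply: cutoff_support; apply: contra xn => /andP[].
  rewrite ltr_pdivlMr// ltr_pdivrMr// mulN1r mul1r => x1 x2.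
  by have := Nn n; move=> ?; apply/andP; split; lra.
have deta0 n x : ~~ (- (2 * n.+1%:R) < x < 2 * n.+1%:R) -> deta n x = 0.
  move=> xn; rewrite /deta cutoff_derive1_support ?mul0r//; apply: contra xn => /andP[].
  by rewrite ltr_pdivlMr// ltr_pdivrMr// mulNr => -> ->.
have etaC n x : `|eta n x| <= C by have [] := cC (x / n.+1%:R).
have detaC n x : `|deta n x| <= C / n.+1%:R.
  rewrite /deta normrM normfV normr_nat ler_pM2r ?invr_gt0//.
  by have [] := cC (x / n.+1%:R).
have ceta n : continuous (eta n) by exact: is_derive_continuous (deta_is n).
pose f_ n x := f x * eta n x.
pose d_ n x := d x * eta n x + f x * deta n x.
have cf_ n : continuous (f_ n) by move=> x; apply: cvgM; [exact: cf|exact: ceta].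
have md_ n : measurable_fun setT (d_ n).
  apply: measurable_funD; apply: measurable_funM => //; exact: continuous_measurable_fun.
have cvn (x : R) : x / n.+1%:R @[n --> \oo] --> (0 : R).
  rewrite -[X in _ --> X](mulr0 x).
  by apply: cvgM; [exact: cvg_cst|exact: cvg_harmonic].
have cveta x : eta n x @[n --> \oo] --> (1 : R).
  rewrite -cutoff0; apply: continuous_cvg; last exact: cvn.
  exact: smooth_continuous.
have cvdeta x : deta n x @[n --> \oo] --> (0 : R).
  rewrite -[X in _ --> X](mulr0 (derive1 cutoff 0)); apply: cvgM; last exact: cvg_harmonic.
  by apply: continuous_cvg; [exact: cdc|exact: cvn].
have cvf x : f_ n x @[n --> \oo] --> f x.
  by rewrite -[f x]mulr1; apply: cvgM => //; exact: cvg_cst.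
have cvd x : d_ n x @[n --> \oo] --> d x.
  have -> : d x = d x * 1 + f x * 0 by rewrite mulr1 mulr0 addr0.
  by apply: cvgD; apply: cvgM => //; exact: cvg_cst.
(* From (y + z)^2 <= 2 y^2 + 2 z^2; the dominating function does not depend on n. *)
have d2C n x : d_ n x ^+ 2 <= 2 * C ^+ 2 * (d x ^+ 2 + f x ^+ 2).
  have sqC y : `|y| <= C -> y ^+ 2 <= C ^+ 2.
    by move=> yC; rewrite -[y ^+ 2]real_normK ?num_real// ler_pXn2r ?nnegrE.
  have e1 := sqC _ (etaC n x).
  have e2 : deta n x ^+ 2 <= C ^+ 2.
    apply: sqC; apply: (le_trans (detaC n x)); rewrite ler_pdivrMr// ler_peMr//.
    by rewrite ler1n.
  have h1 : (d x * eta n x) ^+ 2 <= C ^+ 2 * d x ^+ 2.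
    by rewrite exprMn mulrC ler_wpM2r// sqr_ge0.
  have h2 : (f x * deta n x) ^+ 2 <= C ^+ 2 * f x ^+ 2.
    by rewrite exprMn mulrC ler_wpM2r// sqr_ge0.
  have := sqr_ge0 (d x * eta n x - f x * deta n x).
  rewrite /d_ sqrrB sqrrD -mulrA mulrDr mulrDr.
  by move: h1 h2; move: (d x * eta n x) (f x * deta n x) => y z; lra.
pose X := fine (\int[mu]_x (d x ^+ 2)%:E).
pose X_ n := fine (\int[mu]_x (d_ n x ^+ 2)%:E).
have XE : (\int[mu]_x (d x ^+ 2)%:E)%E = X%:E by rewrite fineK//; exact: integrable_fin_num id2.
have idf : mu.-integrable setT (fun x => (2 * C ^+ 2)%:E * ((d x ^+ 2)%:E + (f x ^+ 2)%:E))%E.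
  by apply: integrableZl => //; exact: integrableD.
have md_2 n : measurable_fun setT (fun x => d_ n x ^+ 2) by exact: measurable_funX.
have id_2 n : mu.-integrable setT (EFin \o (fun x => d_ n x ^+ 2)).
  apply: (le_integrable measurableT _ _ idf); first by apply/measurable_EFinP; exact: md_2.
  move=> x _; rewrite -EFinD -EFinM /= lee_fin ger0_norm ?sqr_ge0//.
  by rewrite ger0_norm// (le_trans _ (d2C n x))// sqr_ge0.
have X_E n : (\int[mu]_x (d_ n x ^+ 2)%:E)%E = (X_ n)%:E.
  by rewrite fineK//; exact: integrable_fin_num (id_2 n).
have X0 : 0 <= X.
  by rewrite -lee_fin -XE; apply: integral_ge0 => x _; rewrite lee_fin sqr_ge0.
have cvX : X_ n @[n --> \oo] --> X.
  have [|||||_ _ c1] := @dominated_convergence _ _ _ mu setT measurableT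
    (fun n x => (d_ n x ^+ 2)%:E) (fun x => (d x ^+ 2)%:E)
    (fun x => (2 * C ^+ 2)%:E * ((d x ^+ 2)%:E + (f x ^+ 2)%:E))%E.
  - by move=> n; apply/measurable_EFinP; exact: md_2.
  - by apply/measurable_EFinP; exact: measurable_funX.
  - apply: aeW => x _; apply: cvg_EFin; first exact: nearW.
    by apply: (@cvg_comp _ _ _ (d_ ^~ x) (fun y => y ^+ 2)); [exact: cvd|exact: exprn_continuous].
  - exact: idf.
  - apply: aeW => x n _; rewrite -EFinD -EFinM lee_fin ger0_norm ?sqr_ge0//.
  by apply: fine_cvg; rewrite -XE.
rewrite unlock XE -EFinM.
(* Each truncated inequality is weakened by K^2 <= S, and lower semicontinuity of the entropy
   carries the result to the limit. *)
apply: (@entropy_sqr_limit _ mu f f_ (fun n => 2 / alpha * S * X_ n) _ C) => //.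
- by move=> n; exact: continuous_measurable_fun.
- move=> n; have M0 : 0 < 2 * n.+1%:R :> R by rewrite mulr_gt0.
  by apply: (continuous_support_bounded M0 (cf_ n)) => x /eta0 ex; rewrite /f_ ex mulr0.
- by move=> n x; rewrite normrM mulrC ler_wpM2r.
- move=> n.
  have nn : - (2 * n.+1%:R) < 2 * n.+1%:R :> R by rewrite gtrN// mulr_gt0.
  have acf_ : abs_continuous_on (- (2 * n.+1%:R)) (2 * n.+1%:R) (f_ n).
    by apply: abs_continuous_onM => //; exact: abs_continuous_on_C1 (deta_is n) (cdeta n).
  have df_ : {ae lebesgue_measure, forall x : R, is_derive x 1 (f_ n) (d_ n x)}.
    apply: filterS aed; first exact: (ae_filter_ringOfSetsType lebesgue_measure).
    by move=> x Dx; exact: is_derive_mul.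
  have := lsi _ _ (f_ n) (d_ n) nn acf_ (cf_ n) _ _ (md_ n) df_.
  move=> /(_ _ _)/le_trans; apply.
  + by move=> x /eta0 ex; rewrite /f_ ex mulr0.
  + by move=> x xn; rewrite /d_ eta0// deta0// !mulr0 addr0.
  rewrite /= -[2 / alpha * S * _]mulrA [leRHS]EFinM lee_wpmul2l ?lee_fin// unlock.
  rewrite EFinM -X_E -ge0_integralZl//.
  + apply: ge0_le_integral => //.
    * by move=> x _; rewrite lee_fin sqr_ge0.
    * apply/measurable_EFinP; apply: measurable_funX; apply: measurable_funM; last exact: md_.
      by apply: continuous_measurable_fun; exact: smooth_continuous.
    * by apply: measurable_funeM; apply/measurable_EFinP; exact: md_2.
    * by move=> x _; rewrite -EFinM lee_fin exprMn ler_wpM2r// sqr_ge0.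
  + by apply/measurable_EFinP; exact: md_2.
  + by move=> x _; rewrite lee_fin sqr_ge0.
- by apply: cvgM => //; exact: cvg_cst.
- exact: (mulr_ge0 (mulr_ge0 a0 S0) X0).
Qed.
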